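(* Assume that the quiver $\Gamma$ of $\Lambda=K\Gamma/I$ is without double arrows (no two distinct arrows share both starting and terminal vertex). Let $p\in K\Gamma$ be a mast of positive length starting in the vertex $e$ and satisfying the following condition: Whenever $(\alpha,u)$ is a slack halyard on $p$ and $X_r(\alpha,u)$ is a slack variable, there exists a right subpath $w_r(\alpha,u):e\to e$ of $p$ such that $v_r(\alpha,u)=\alpha u\,w_r(\alpha,u)$ in $K\Gamma$. Then there are only finitely many uniserial left $\Lambda$-modules with mast $p$, up to isomorphism.
   Context: **Setting.** $K$ is an infinite field, $\Gamma$ a finite quiver, $I$ an admissible ideal of the path algebra $K\Gamma$, $\Lambda=K\Gamma/I$ (a finite dimensional split basic $K$-algebra), and $J$ its Jacobson radical. Vertices of $\Gamma$ are identified with the corresponding primitive idempotents of $\Lambda$. Paths are composed so that $qp$ means ''$q$ after $p$''; vertices are the paths of length $0$. A right subpath of a path $p$ is a path $u$ with $p=u'u$ in $K\Gamma$ for some path $u'$ (lengths $0$ allowed). Modules are finitely generated left modules. **Uniserial modules, masts.** A module is uniserial if its submodules form a chain. If $U$ is uniserial of composition length $l+1$, a mast of $U$ is a path $p$ in $K\Gamma$ of length $l$ with $pU\neq 0$; a path is called a mast if it is a mast of some uniserial left $\Lambda$-module. A top element of $U$ is an element $x\in U\setminus JU$ with $x=ex$ for a vertex $e$. **Detours and $V_p$.** Let $p$ be a path. A detour on $p$ is a pair $(\alpha,u)$ with $u$ a right subpath of $p$ (possibly of length $0$) and $\alpha$ an arrow such that $\alpha u$ is a path which is not a right subpath of $p$,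 but there is a right subpath of $p$ strictly longer than $u$ ending in the same vertex as $\alpha$. All right subpaths of $p$ that are longer than $u$ and end in the same vertex as $\alpha$ are denoted $v_i(\alpha,u)$, $i\in I(\alpha,u)$. Let $D$ be the set of triples $(\alpha,u,i)$ with $(\alpha,u)$ a detour on $p$ and $i\in I(\alpha,u)$, with corresponding independent variables $X_i(\alpha,u)$. $V_p\subseteq K^D$ is the set of all points $k=(k_i(\alpha,u))$ for which there are a uniserial left $\Lambda$-module $U$ with mast $p$ and a top element $x$ of $U$ with $\alpha ux=\sum_{i\in I(\alpha,u)}k_i(\alpha,u)v_i(\alpha,u)x$ for all detours $(\alpha,u)$ on $p$; this set is known to be Zariski closed. $A_p$ is the coordinate ring of $V_p$, i.e. the polynomial ring in the $X_i(\alpha,u)$ modulo the ideal of polynomials vanishing on $V_p$. **Halyards.** Let $p$ be a mast. A detour $(\alpha,u)$ on $p$ is a halyard on $p$ if some $X_j(\alpha,u)$ has nonzero image in $A_p$ (equivalently, $\alpha ux\neq0$ for some uniserial module with mast $p$ and some top element $x$ of it). A variable $X_j(\alpha,u)$ of a halyard $(\alpha,u)$ is slack if its image in $A_p$ is transcendental over $K$ (equivalently, the coordinate $k_j(\alpha,u)$ takes infinitely many values on $V_p$). A halyard is slack if it has at least one slack variable. *)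

(* Defs.v *)
From HB Require Import structures.
From mathcomp Require Import all_boot all_order all_algebra.
From mathcomp Require Import generic_quotient ring_quotient.
From mathcomp Require boolp monalg mpoly.

Set Implicit Arguments.
Unset Strict Implicit.
Unset Printing Implicit Defensive.

Import GRing.Theory.
Local Open Scope ring_scope.
Local Open Scope quotient_scope.

(* Quotient of a ring by a two-sided ideal. The ring structure MathComp puts on
   {ideal_quot I} covers only commutative rings and proper ideals. *)

HB.mixin Record isTwoSidedIdeal (R : pzRingType) (S : {pred R}) := {
  idealMl_subproof : forall a u : R, u \in S -> a * u \in S;
  idealMr_subproof : forall a u : R, u \in S -> u * a \in S
}.

#[short(type="idealType")]
HB.structure Definition TwoSidedIdeal (R : pzRingType) :=
  {S of GRing.ZmodClosed R S & isTwoSidedIdeal R S}.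

Section RingQuot.
Variables (R : pzRingType) (I : idealType R).

Lemma idealMl a u : u \in I -> a * u \in I.
Proof. exact: idealMl_subproof. Qed.

Lemma idealMr a u : u \in I -> u * a \in I.
Proof. exact: idealMr_subproof. Qed.

Local Notation Q := {ideal_quot I}.

Definition ring_quot : Type := Q.

Definition rq_one : Q := lift_cst Q 1.
Definition rq_mul : Q -> Q -> Q := lift_op2 Q *%R.

Lemma pi_rq_one : \pi_Q 1 = rq_one.
Proof. by rewrite /rq_one; unlock. Qed.

Lemma pi_rq_mul : {morph \pi_Q : x y / x * y >-> rq_mul x y}.
Proof.
move=> x y; unlock rq_mul; apply/eqP; rewrite piE Quotient.equivE.
rewrite -[_ * _](addrNK (x * repr (\pi_Q y))) -mulrBr -addrA -mulrBl rpredD //.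
  by rewrite idealMl // Quotient.idealrBE reprK.
by rewrite idealMr // Quotient.idealrBE reprK.
Qed.

Fact rq_mulA : associative rq_mul.
Proof.
move=> x y z; rewrite -[x]reprK -[y]reprK -[z]reprK.
by rewrite -!pi_rq_mul mulrA.
Qed.

Fact rq_mul1r : left_id rq_one rq_mul.
Proof. by move=> x; rewrite -[x]reprK -pi_rq_one -pi_rq_mul mul1r. Qed.

Fact rq_mulr1 : right_id rq_one rq_mul.
Proof. by move=> x; rewrite -[x]reprK -pi_rq_one -pi_rq_mul mulr1. Qed.

Fact rq_mulDl : left_distributive rq_mul +%R.
Proof.
move=> x y z; rewrite -[x]reprK -[y]reprK -[z]reprK.
by rewrite -!pi_rq_mul -!raddfD -pi_rq_mul mulrDl.
Qed.

Fact rq_mulDr : right_distributive rq_mul +%R.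
Proof.
move=> x y z; rewrite -[x]reprK -[y]reprK -[z]reprK.
by rewrite -!pi_rq_mul -!raddfD -pi_rq_mul mulrDr.
Qed.

HB.instance Definition _ := GRing.Zmodule.on ring_quot.
HB.instance Definition _ := GRing.Zmodule_isPzRing.Build ring_quot
  rq_mulA rq_mul1r rq_mulr1 rq_mulDl rq_mulDr.

Definition rquot (a : R) : ring_quot := \pi_Q a.

Fact rquot_is_zmod_morphism : zmod_morphism rquot.
Proof. exact: (@raddfB _ _ \pi_Q). Qed.

Fact rquot_is_monoid_morphism : monoid_morphism rquot.
Proof. by split; [exact: pi_rq_one | exact: pi_rq_mul]. Qed.

HB.instance Definition _ :=
  GRing.isZmodMorphism.Build R ring_quot rquot rquot_is_zmod_morphism.
HB.instance Definition _ :=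
  GRing.isMonoidMorphism.Build R ring_quot rquot rquot_is_monoid_morphism.

Lemma rquot_surj (x : ring_quot) : exists a, rquot a = x.
Proof. by exists (repr (x : Q)); exact: reprK. Qed.

Lemma rquot_eq0 a : (rquot a == 0) = (a \in I).
Proof.
by rewrite -(raddf0 rquot) -[a in RHS]subr0 Quotient.idealrBE.
Qed.

End RingQuot.

Arguments rquot {R} I a.

(* Quivers and paths. A path is a source vertex together with the list of its
   arrows in the order in which they are traversed. *)

Record quiver := Quiver {
  vertex : finType;
  arrow : finType;
  source : arrow -> vertex;
  target : arrow -> vertex
}.

Fixpoint is_walk (Q : quiver) (e : vertex Q) (s : seq (arrow Q)) : bool :=
  if s is a :: s' then (source a == e) && is_walk (target a) s' else true.

Record qpath (Q : quiver) := QPath {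
  qpath_val : vertex Q * seq (arrow Q);
  _ : is_walk qpath_val.1 qpath_val.2
}.

HB.instance Definition _ Q := [isSub for @qpath_val Q].
HB.instance Definition _ Q := [Countable of qpath Q by <:].

Section Paths.
Variable Q : quiver.
Implicit Types p q r u v : qpath Q.

Definition psource p : vertex Q := (val p).1.
Definition parrows p : seq (arrow Q) := (val p).2.
Definition ptarget p : vertex Q := last (psource p) (map (@target Q) (parrows p)).
Definition plength p : nat := size (parrows p).

Definition vpath (e : vertex Q) : qpath Q := @QPath Q (e, [::]) isT.

Fact apath_subproof (a : arrow Q) : is_walk (source a) [:: a].
Proof. by rewrite /= eqxx. Qed.
Definition apath (a : arrow Q) : qpath Q :=
  @QPath Q (source a, [:: a]) (apath_subproof a).

(* [pcomp q p] is the path qp, "q after p". *)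
Definition pcomp q p : option (qpath Q) :=
  if ptarget p == psource q then insub (psource p, parrows p ++ parrows q)
  else None.

Lemma is_walk_cat (e : vertex Q) s1 s2 :
  is_walk e (s1 ++ s2)
  = is_walk e s1 && is_walk (last e (map (@target Q) s1)) s2.
Proof. by elim: s1 e => //= a s1 IH e; rewrite IH andbA. Qed.

Lemma qpath_walk p : is_walk (psource p) (parrows p).
Proof. by case: p. Qed.

Lemma pcompP q p r :
  pcomp q p = Some r <->
  [/\ ptarget p = psource q, psource r = psource p
    & parrows r = parrows p ++ parrows q].
Proof.
rewrite /pcomp; case: (ptarget p =P _) => [e|ne]; last by split=> // -[].
have w : is_walk (psource p) (parrows p ++ parrows q).
  by rewrite is_walk_cat qpath_walk -/(ptarget p) e qpath_walk.
rewrite insubT; split=> [[<-] //|[_ rs ra]].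
congr Some; apply: val_inj => /=.
by rewrite [RHS]surjective_pairing -/(psource r) -/(parrows r) rs ra.
Qed.

Lemma pcompN q p : pcomp q p = None <-> ptarget p <> psource q.
Proof.
rewrite /pcomp; case: (ptarget p =P _) => // e; rewrite insubT; last by split.
by rewrite is_walk_cat qpath_walk -/(ptarget p) e qpath_walk.
Qed.

Definition right_subpath u p : Prop := exists u', pcomp u' u = Some p.

Definition rsubpaths p : seq (qpath Q) :=
  pmap insub [seq (psource p, take i (parrows p)) | i <- iota 0 (plength p).+1].

Lemma rsubpathP u p : reflect (right_subpath u p) (u \in rsubpaths p).
Proof.
have -> : (u \in rsubpaths p)
    = (psource u == psource p) && prefix (parrows u) (parrows p).
  rewrite /rsubpaths mem_pmap_sub.
  apply/mapP/andP => [[i _ ui]|[/eqP us /prefixP[s ps]]].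
    by rewrite /psource /parrows ui prefix_take.
  exists (plength u); last first.
    rewrite ps take_size_cat // -us; exact: surjective_pairing.
  by rewrite mem_iota /= add0n ltnS /plength ps size_cat leq_addr.
apply: (iffP andP) => [[/eqP us /prefixP[s ps]]|[u' /pcompP[_ -> ->]]].
  have w : is_walk (ptarget u) s.
    have := qpath_walk p; rewrite ps is_walk_cat -us.
    by case/andP.
  exists (@QPath Q (ptarget u, s) w); apply/pcompP; split=> //.
by rewrite eqxx prefix_prefix.
Qed.

End Paths.

(* The path algebra: finitely supported K-combinations of paths, with the
   K-bilinear product extending composition of paths (0 when undefined). *)

Module PathAlgebra.
Import finmap monalg.

Section Def.
Variables (K : fieldType) (Q : quiver).

Definition pathalg : Type := {malg K[qpath Q]}.
HB.instance Definition _ := GRing.Lmodule.copy pathalg {malg K[qpath Q]}.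

End Def.

HB.lock Definition pbasis (K : fieldType) (Q : quiver) (p : qpath Q) :
  pathalg K Q := << p >>.

HB.lock Definition pcoef (K : fieldType) (Q : quiver) (a : pathalg K Q)
  (p : qpath Q) : K := a@_p.

Section Def2.
Variables (K : fieldType) (Q : quiver).
Local Notation pathalg := (pathalg K Q).
Local Notation pbasis := (@pbasis K Q).

Definition pathalg_one : pathalg := \sum_(e : vertex Q) pbasis (vpath e).

Definition pbasis_mul (q p : qpath Q) : pathalg := oapp pbasis 0 (pcomp q p).

End Def2.

HB.lock Definition pathalg_mul (K : fieldType) (Q : quiver)
    (a b : pathalg K Q) : pathalg K Q :=
  \sum_(q <- msupp a) \sum_(p <- msupp b)
    (pcoef a q * pcoef b p) *: pbasis_mul K q p.

Section Theory.
Variables (K : fieldType) (Q : quiver).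
Local Notation pathalg := (pathalg K Q).
Local Notation pbasis := (@pbasis K Q).
Local Notation pbasis_mul := (@pbasis_mul K Q).
Local Notation pathalg_one := (pathalg_one K Q).
Local Notation pathalg_mul := (@pathalg_mul K Q).

Lemma pathalgP (a b : pathalg) : (forall p, pcoef a p = pcoef b p) <-> a = b.
Proof. by rewrite unlock; exact: malgP. Qed.

Lemma pcoefD (a b : pathalg) p : pcoef (a + b) p = pcoef a p + pcoef b p.
Proof. by rewrite unlock; exact: mcoeffD. Qed.

Lemma pcoefZ c (a : pathalg) p : pcoef (c *: a) p = c * pcoef a p.
Proof. by rewrite unlock; exact: mcoeffZ. Qed.

Lemma pcoef_basis p q : pcoef (pbasis p) q = (p == q)%:R.
Proof. by rewrite !unlock; exact: mcoeffU. Qed.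

(* K-linear extension of a map defined on paths *)
Let lext (F : qpath Q -> pathalg) (a : pathalg) : pathalg :=
  \sum_(p <- msupp a) pcoef a p *: F p.

Let lextw F (a : pathalg) (d : {fset qpath Q}) : (msupp a `<=` d)%fset ->
  lext F a = \sum_(p <- d) pcoef a p *: F p.
Proof.
move=> le; rewrite /lext; apply/big_fset_incl => // k _ /mcoeff_outdom.
by rewrite unlock => ->; rewrite scale0r.
Qed.

Let lextD F a b : lext F (a + b) = lext F a + lext F b.
Proof.
rewrite (lextw F (msuppD_le _ _)) (lextw F (fsubsetUl _ (msupp b))).
rewrite (lextw F (fsubsetUr (msupp a) _)) -big_split; apply: eq_bigr => p _.
by rewrite pcoefD scalerDl.
Qed.

Let lextZ F c a : lext F (c *: a) = c *: lext F a.
Proof.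
rewrite (lextw F (msuppZ_le _ _)) scaler_sumr; apply: eq_bigr => p _.
by rewrite pcoefZ scalerA.
Qed.

Let lext0 F : lext F 0 = 0.
Proof. by rewrite -(scale0r (0 : pathalg)) lextZ !scale0r. Qed.

Let lextU F p : lext F (pbasis p) = F p.
Proof.
have sub : (msupp (pbasis p) `<=` [fset p])%fset by rewrite unlock msuppU_le.
by rewrite (lextw F sub) big_seq_fset1 pcoef_basis eqxx scale1r.
Qed.

Let lext_sum F I (r : seq I) (P : pred I) (f : I -> pathalg) :
  lext F (\sum_(i <- r | P i) f i) = \sum_(i <- r | P i) lext F (f i).
Proof. exact: (big_morph (lext F) (lextD F) (lext0 F)). Qed.

Let lext_id a : lext pbasis a = a.
Proof.
rewrite [RHS]monalgE; apply: eq_bigr => p _; apply/pathalgP => k.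
by rewrite pcoefZ pcoef_basis mulr_natr !unlock -mcoeffU.
Qed.

Let lext_comp F G a : lext F (lext G a) = lext (fun p => lext F (G p)) a.
Proof. by rewrite {2}/lext lext_sum; apply: eq_bigr => p _; rewrite lextZ. Qed.

Let mulE a b : pathalg_mul a b = lext (fun q => lext (pbasis_mul q) b) a.
Proof.
rewrite unlock; apply: eq_bigr => q _; rewrite scaler_sumr.
by apply: eq_bigr => p _; rewrite scalerA.
Qed.

Let mulDl : left_distributive pathalg_mul +%R.
Proof. by move=> a b c; rewrite !mulE lextD. Qed.

Let mulDr : right_distributive pathalg_mul +%R.
Proof.
move=> a b c; rewrite !mulE -big_split; apply: eq_bigr => p _.
by rewrite lextD scalerDr.
Qed.

Let mulZl c a b : pathalg_mul (c *: a) b = c *: pathalg_mul a b.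
Proof. by rewrite !mulE lextZ. Qed.

Let mulZr c a b : pathalg_mul a (c *: b) = c *: pathalg_mul a b.
Proof.
rewrite !mulE scaler_sumr; apply: eq_bigr => p _.
by rewrite lextZ !scalerA mulrC.
Qed.

Let mul0l a : pathalg_mul 0 a = 0.
Proof. by rewrite mulE lext0. Qed.

Let mul0r a : pathalg_mul a 0 = 0.
Proof. by rewrite -(scale0r (0 : pathalg)) mulZr !scale0r. Qed.

Let mulUU q p : pathalg_mul (pbasis q) (pbasis p) = pbasis_mul q p.
Proof. by rewrite mulE !lextU. Qed.

Let mul_suml I (r : seq I) (P : pred I) (f : I -> pathalg) b :
  pathalg_mul (\sum_(i <- r | P i) f i) b
  = \sum_(i <- r | P i) pathalg_mul (f i) b.
Proof.
exact: (big_morph (pathalg_mul^~ b) (fun x y => mulDl x y b) (mul0l b)).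
Qed.

Let mul_sumr I (r : seq I) (P : pred I) (f : I -> pathalg) b :
  pathalg_mul b (\sum_(i <- r | P i) f i)
  = \sum_(i <- r | P i) pathalg_mul b (f i).
Proof. exact: (big_morph (pathalg_mul b) (mulDr b) (mul0r b)). Qed.

Let ptarget_comp (q p r : qpath Q) : pcomp q p = Some r ->
  ptarget r = ptarget q.
Proof.
case/pcompP=> [e rs ra].
by rewrite /ptarget rs ra map_cat last_cat -/(ptarget p) e.
Qed.

Let pcompA (q p r : qpath Q) :
  obind (pcomp q) (pcomp p r) = obind (fun y => pcomp y r) (pcomp q p).
Proof.
case pr: (pcomp p r) => [x|]; case qp: (pcomp q p) => [y|] //=.
- case/pcompP: (pr) => e1 xs xa; case/pcompP: (qp) => e2 ys ya.
  case qx: (pcomp q x) => [z|]; last first.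
    by case/pcompN: qx; rewrite (ptarget_comp pr).
  apply/esym/pcompP; case/pcompP: qx => e3 zs za.
  by rewrite e1 ys zs xs za xa ya catA.
- by apply/pcompN; rewrite (ptarget_comp pr); apply/pcompN.
- apply/esym/pcompN; case/pcompP: (qp) => _ -> _; exact/pcompN.
Qed.

Let mulUUU q p r : pathalg_mul (pbasis q) (pbasis_mul p r)
                 = pathalg_mul (pbasis_mul q p) (pbasis r).
Proof.
have := pcompA q p r; rewrite /pbasis_mul.
case: (pcomp p r) (pcomp q p) => [x|] [y|] /=;
  rewrite ?mul0l ?mul0r ?mulUU /pbasis_mul => // e; by [rewrite e | rewrite -e].
Qed.

Let eq_lin (F G : pathalg -> pathalg) :
  (forall a b, F (a + b) = F a + F b) -> (forall c a, F (c *: a) = c *: F a) ->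
  (forall a b, G (a + b) = G a + G b) -> (forall c a, G (c *: a) = c *: G a) ->
  (forall p, F (pbasis p) = G (pbasis p)) -> forall a, F a = G a.
Proof.
move=> FD FZ GD GZ FG a.
have F0 : F 0 = 0 by rewrite -(scale0r (0 : pathalg)) FZ !scale0r.
have G0 : G 0 = 0 by rewrite -(scale0r (0 : pathalg)) GZ !scale0r.
rewrite -[a]lext_id /lext (big_morph F FD F0) (big_morph G GD G0).
by apply: eq_bigr => p _; rewrite FZ GZ FG.
Qed.

Let mulA : associative pathalg_mul.
Proof.
move=> a b c; pose m := pathalg_mul.
apply: (eq_lin (F := fun x => m x (m b c)) (G := fun x => m (m x b) c))
  => [x y|k x|x y|k x|q]; rewrite /m ?mulDl ?mulZl ?mulDl ?mulZl //.
apply: (eq_lin (F := fun x => m (pbasis q) (m x c))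
               (G := fun x => m (m (pbasis q) x) c))
  => [x y|k x|x y|k x|p]; rewrite /m.
- by rewrite mulDl mulDr.
- by rewrite mulZl mulZr.
- by rewrite mulDr mulDl.
- by rewrite mulZr mulZl.
apply: (eq_lin (F := fun x => m (pbasis q) (m (pbasis p) x))
               (G := fun x => m (m (pbasis q) (pbasis p)) x))
  => [x y|k x|x y|k x|r]; rewrite /m.
- by rewrite !mulDr.
- by rewrite !mulZr.
- by rewrite mulDr.
- by rewrite mulZr.
by rewrite !mulUU mulUUU.
Qed.

Let sum_vpath_l p :
  \sum_(e : vertex Q) pbasis_mul (vpath e) p = pbasis p.
Proof.
rewrite (bigD1 (ptarget p)) //= big1 ?addr0 => [|e ne]; rewrite /pbasis_mul.
  suff -> : pcomp (vpath (ptarget p)) p = Some p by [].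
  by apply/pcompP; rewrite cats0.
suff -> : pcomp (vpath e) p = None by [].
by apply/pcompN => pe; case/eqP: ne.
Qed.

Let sum_vpath_r p :
  \sum_(e : vertex Q) pbasis_mul p (vpath e) = pbasis p.
Proof.
rewrite (bigD1 (psource p)) //= big1 ?addr0 => [|e ne]; rewrite /pbasis_mul.
  suff -> : pcomp p (vpath (psource p)) = Some p by [].
  exact/pcompP.
suff -> : pcomp p (vpath e) = None by [].
by apply/pcompN => pe; case/eqP: ne.
Qed.

Let mul1l : left_id pathalg_one pathalg_mul.
Proof.
apply: (eq_lin (F := fun a => pathalg_mul pathalg_one a) (G := id))
  => [a b|c a|//|//|p]; [exact: mulDr|exact: mulZr|].
rewrite /pathalg_one mul_suml -[RHS]sum_vpath_l.
by apply: eq_bigr => e _; rewrite mulUU.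
Qed.

Let mul1r : right_id pathalg_one pathalg_mul.
Proof.
apply: (eq_lin (F := fun a => pathalg_mul a pathalg_one) (G := id))
  => [a b|c a|//|//|p]; [exact: mulDl|exact: mulZl|].
rewrite /pathalg_one mul_sumr -[RHS]sum_vpath_r.
by apply: eq_bigr => e _; rewrite mulUU.
Qed.

HB.instance Definition _ := GRing.Zmodule_isPzRing.Build pathalg
  mulA mul1l mul1r mulDl mulDr.

Lemma pbasisM q p : pbasis q * pbasis p = oapp pbasis 0 (pcomp q p).
Proof. exact: mulUU. Qed.

Lemma pathalg_scaleAl c (a b : pathalg) : c *: (a * b) = (c *: a) * b.
Proof. exact/esym/mulZl. Qed.

Lemma pathalg_scaleAr c (a b : pathalg) : c *: (a * b) = a * (c *: b).
Proof. exact/esym/mulZr. Qed.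

Lemma pathalgE (a : pathalg) :
  a = \sum_(p <- msupp a) pcoef a p *: pbasis p.
Proof. exact/esym/lext_id. Qed.

End Theory.
End PathAlgebra.
Export PathAlgebra.

(* The m-th power of the arrow ideal is spanned by the paths of length >= m. *)
Definition arrow_ideal_pow (K : fieldType) (Q : quiver) (m : nat)
    (a : pathalg K Q) : Prop :=
  forall p : qpath Q, pcoef a p != 0 -> (m <= plength p)%N.

Definition admissible (K : fieldType) (Q : quiver)
    (I : idealType (pathalg K Q)) : Prop :=
  (forall a, a \in I -> arrow_ideal_pow 2 a) /\
  exists2 m : nat, (2 <= m)%N & forall a, arrow_ideal_pow m a -> a \in I.

Section RingModules.
Variable R : pzRingType.

Definition finitely_generated (M : lmodType R) : Prop :=
  exists (n : nat) (g : 'I_n -> M),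
    forall x : M, exists c : 'I_n -> R, x = \sum_(i < n) c i *: g i.

Definition isomorphic (M N : lmodType R) : Prop :=
  exists f : {linear M -> N}, bijective f.

(* Submodules are boolean predicates, as for submod_closed; classically this is
   no restriction. *)
Definition uniserial (M : lmodType R) : Prop :=
  forall N1 N2 : {pred M}, submod_closed N1 -> submod_closed N2 ->
    {subset N1 <= N2} \/ {subset N2 <= N1}.

(* N1 is a maximal proper submodule of N2, i.e. N2 / N1 is simple. *)
Definition simple_step (M : lmodType R) (N1 N2 : {pred M}) : Prop :=
  [/\ {subset N1 <= N2}, ~ {subset N2 <= N1}
    & forall N : {pred M}, submod_closed N ->
        {subset N1 <= N} -> {subset N <= N2} ->
        {subset N <= N1} \/ {subset N2 <= N}].

Definition composition_length (M : lmodType R) (n : nat) : Prop :=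
  exists N : nat -> {pred M},
    [/\ N 0 =i pred1 0, N n =i predT,
        forall i, (i <= n)%N -> submod_closed (N i)
      & forall i, (i < n)%N -> simple_step (N i) (N i.+1)].

Definition maximal_left_ideal (L : {pred R^o}) : Prop :=
  submod_closed L /\ simple_step L predT.

Definition jacobson_radical (a : R) : Prop :=
  forall L : {pred R^o}, maximal_left_ideal L -> a \in L.

(* JM, for J the Jacobson radical of R *)
Definition in_radical (M : lmodType R) (x : M) : Prop :=
  exists (n : nat) (j : 'I_n -> R) (y : 'I_n -> M),
    (forall i, jacobson_radical (j i)) /\ x = \sum_(i < n) j i *: y i.

End RingModules.

Section Detours.
Variables (Q : quiver) (p : qpath Q).

(* The right subpaths v_i(alpha, u); each serves as its own index i. *)
Definition detour_targets (a : arrow Q) (u : qpath Q) : seq (qpath Q) :=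
  [seq v <- rsubpaths p | (plength u < plength v)%N & ptarget v == target a].

Definition detour (a : arrow Q) (u : qpath Q) : bool :=
  [&& u \in rsubpaths p,
      oapp (fun w => w \notin rsubpaths p) false (pcomp (apath a) u)
    & detour_targets a u != [::]].

(* The set D of triples (alpha, u, i). *)
Definition detour_index : finType :=
  {d : arrow Q * seq_sub (rsubpaths p) * seq_sub (rsubpaths p)
     | detour d.1.1 (val d.1.2) && (val d.2 \in detour_targets d.1.1 (val d.1.2))}.

Definition d_arrow (d : detour_index) : arrow Q := (val d).1.1.
Definition d_path (d : detour_index) : qpath Q := val (val d).1.2.
Definition d_target (d : detour_index) : qpath Q := val (val d).2.

End Detours.

Section Uniserial.
Variables (K : fieldType) (Q : quiver) (I : idealType (pathalg K Q)).

Definition qalgebra : pzRingType := ring_quot I.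

(* Action of the path algebra on modules over its quotient *)
Definition pact (M : lmodType qalgebra) (a : pathalg K Q) (x : M) : M :=
  rquot I a *: x.

Definition mast_of (M : lmodType qalgebra) (p : qpath Q) : Prop :=
  [/\ uniserial M, composition_length M (plength p).+1
    & exists x : M, pact (pbasis K p) x <> 0].

Definition mast (p : qpath Q) : Prop :=
  exists2 M : lmodType qalgebra, finitely_generated M & mast_of M p.

Definition top_element (M : lmodType qalgebra) (x : M) : Prop :=
  ~ in_radical x /\ exists e : vertex Q, x = pact (pbasis K (vpath e)) x.

Section Variety.
Variable p : qpath Q.

Definition in_V (k : detour_index p -> K) : Prop :=
  exists (M : lmodType qalgebra) (x : M),
    [/\ finitely_generated M, mast_of M p, top_element x
      & forall (a : arrow Q) (u : qpath Q), detour p a u ->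
          pact (pbasis K (apath a) * pbasis K u) x
          = \sum_(d : detour_index p | (d_arrow d == a) && (d_path d == u))
              pact (k d *: pbasis K (d_target d)) x].

Local Notation n := #|detour_index p|.

Import mpoly.

Definition X (d : detour_index p) : {mpoly K[n]} := 'X_(enum_rank d).

Definition vanishing : {pred {mpoly K[n]}} := fun f =>
  boolp.asbool (forall k, in_V k -> f.@[fun i => k (enum_val i)] = 0).

Lemma vanishingP f :
  reflect (forall k, in_V k -> f.@[fun i => k (enum_val i)] = 0)
          (f \in vanishing).
Proof. exact: boolp.asboolP. Qed.

Fact vanishing_zmod_closed : zmod_closed vanishing.
Proof.
split=> [|f g /vanishingP fV /vanishingP gV].
  by apply/vanishingP => k _; rewrite meval0.
by apply/vanishingP => k kV; rewrite mevalB fV ?gV ?subrr.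
Qed.

Fact vanishingMl (f g : {mpoly K[n]}) : g \in vanishing -> f * g \in vanishing.
Proof.
by move=> /vanishingP gV; apply/vanishingP => k kV; rewrite mevalM gV ?mulr0.
Qed.

Fact vanishingMr (f g : {mpoly K[n]}) : g \in vanishing -> g * f \in vanishing.
Proof. by rewrite mulrC; exact: vanishingMl. Qed.

HB.instance Definition _ :=
  GRing.isZmodClosed.Build {mpoly K[n]} vanishing vanishing_zmod_closed.
HB.instance Definition _ :=
  isTwoSidedIdeal.Build {mpoly K[n]} vanishing vanishingMl vanishingMr.

(* The coordinate ring A_p of V_p *)
Definition coord_ring : pzRingType := ring_quot vanishing.

Definition coord_X (d : detour_index p) : coord_ring := rquot vanishing (X d).

Definition coord_const (c : K) : coord_ring := rquot vanishing c%:MP.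

Definition transcendental (z : coord_ring) : Prop :=
  forall f : {poly K},
    \sum_(i < size f) coord_const f`_i * z ^+ i = 0 -> f = 0.

Definition halyard (a : arrow Q) (u : qpath Q) : Prop :=
  detour p a u /\
  exists d : detour_index p, [/\ d_arrow d = a, d_path d = u & coord_X d <> 0].

Definition slack_variable (d : detour_index p) : Prop :=
  halyard (d_arrow d) (d_path d) /\ transcendental (coord_X d).

Definition slack_halyard (a : arrow Q) (u : qpath Q) : Prop :=
  halyard a u /\
  exists d : detour_index p, [/\ d_arrow d = a, d_path d = u & slack_variable d].

End Variety.
End Uniserial.

(* Main.v *)
Require Import Defs.
From mathcomp Require Import all_boot all_algebra.
From HB Require Import structures.
From mathcomp Require boolp mpoly.

Import GRing.Theory.
Local Open Scope ring_scope.
Local Notation pcomp := Defs.pcomp.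

(** If [U] has mast [p] and [x] is a top element, the elements [v x], for [v] a
    right subpath of [p], form a basis of [U] adapted to its composition series,
    and the coordinates of the [alpha u x], for the detours [(alpha, u)], determine
    the annihilator of [x], hence [U].  A coordinate that is not slack is a root of
    a fixed nonzero polynomial, so it takes finitely many values.  The slack ones
    can all be made zero by changing [x]: if [v = alpha u w], then replacing [x] by
    [x - k w x] subtracts [k] from the coordinate of [v] in [alpha u x].  This
    leaves unchanged every coordinate [(beta, u', v')] with
    [|v'| - |u'| - 1 < |w|], because [|v'| >= |u'| + 2] in the absence of double
    arrows; and each [w] belongs to only one slack coordinate.  Treating the slack
    coordinates by increasing length of [w] therefore works. *)

(** * Right subpaths and detours *)

Section Paths.
Set Implicit Arguments.
Unset Strict Implicit.
Variable Q : quiver.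
Implicit Types p q u v w : qpath Q.

Lemma qpath_eq q1 q2 :
  psource q1 = psource q2 -> parrows q1 = parrows q2 -> q1 = q2.
Proof.
move=> es ea; apply: val_inj.
by case: q1 q2 es ea => [[? ?] ?] [[? ?] ?]; rewrite /psource /parrows /= => -> ->.
Qed.

Lemma is_walk_take p j : is_walk (psource p) (take j (parrows p)).
Proof.
by have := qpath_walk p; rewrite -{1}(cat_take_drop j (parrows p)) is_walk_cat;
  case/andP.
Qed.

(* The right subpath of [p] of length [j], which is [p] itself for
   [j >= plength p]. *)
Definition rsub p j : qpath Q :=
  @QPath Q (psource p, take j (parrows p)) (is_walk_take p j).

Lemma plength_rsub p j : (j <= plength p)%N -> plength (rsub p j) = j.
Proof. exact: size_takel. Qed.

Lemma rsub0 p : rsub p 0 = vpath (psource p).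
Proof. by apply: qpath_eq => //; rewrite [LHS]take0. Qed.

Lemma rsub_in p j : rsub p j \in rsubpaths p.
Proof.
have [v vw] : exists v, psource v = ptarget (rsub p j) /\
                        parrows v = drop j (parrows p).
  have := qpath_walk p; rewrite -{1}(cat_take_drop j (parrows p)) is_walk_cat.
  case/andP=> _ w; by exists (@QPath Q (_, _) w).
apply/rsubpathP; exists v; apply/pcompP; split=> //; first by case: vw.
by case: vw => _ ->; rewrite cat_take_drop.
Qed.

Lemma rsubpaths_rsub p u : u \in rsubpaths p ->
  u = rsub p (plength u) /\ (plength u <= plength p)%N.
Proof.
case/rsubpathP=> v /pcompP[_ e1 e2]; split; last first.
  by rewrite /plength e2 size_cat leq_addr.
by apply: qpath_eq => //; rewrite [RHS]/= /parrows /= -/(parrows p) e2 take_size_cat.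
Qed.

Lemma plength_pcomp q p r : pcomp q p = Some r ->
  plength r = (plength p + plength q)%N.
Proof. by case/pcompP=> _ _ e; rewrite /plength e size_cat. Qed.

(** Peels off the last arrow traversed, which is the outermost factor when a path acts on a
    module. *)
Lemma qpath_ind (P : qpath Q -> Prop) :
  (forall e, P (vpath e)) ->
  (forall a u q, P u -> pcomp (apath a) u = Some q -> P q) -> forall q, P q.
Proof.
move=> P0 PS q; have [n] := ubnP (plength q); elim: n q => // n IH q.
case e: (parrows q) / (lastP (parrows q)) => [|s a] sz.
  suff -> : q = vpath (psource q) by apply: P0.
  by apply: qpath_eq; rewrite ?e.
have w := qpath_walk q; rewrite e -cats1 is_walk_cat /= andbT in w.
case/andP: w => w /eqP sa.
apply: (PS a (@QPath Q (psource q, s) w)); last first.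
  by apply/pcompP; rewrite /parrows /= -/(parrows q) e cats1.
by apply: IH; move: sz; rewrite /plength e size_rcons ltnS.
Qed.

Lemma detour_src p a u : detour p a u -> u \in rsubpaths p.
Proof. by case/and3P. Qed.

Lemma detour_targetsP p a u v : v \in detour_targets p a u ->
  [/\ v = rsub p (plength v), (plength u < plength v <= plength p)%N
    & ptarget v = target a].
Proof.
rewrite mem_filter => /andP[/andP[lt /eqP t] /rsubpaths_rsub[e le]].
by rewrite lt le.
Qed.

Lemma d_detour p (d : detour_index p) : detour p (d_arrow d) (d_path d).
Proof. by case/andP: (valP d). Qed.

Lemma d_targetP p (d : detour_index p) :
  d_target d \in detour_targets p (d_arrow d) (d_path d).
Proof. by case/andP: (valP d). Qed.

Lemma detour_indexP p a u v : detour p a u -> v \in detour_targets p a u ->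
  exists d : detour_index p, [/\ d_arrow d = a, d_path d = u & d_target d = v].
Proof.
move=> dt vt; have ui := detour_src dt.
have vi : v \in rsubpaths p by move: vt; rewrite mem_filter => /andP[].
have h : detour p a (val (SeqSub ui)) &&
         (val (SeqSub vi) \in detour_targets p a (val (SeqSub ui))).
  by rewrite /= dt vt.
by exists (exist _ (a, SeqSub ui, SeqSub vi) h).
Qed.

(** A target is a right subpath of [p], hence determined by its length. *)
Lemma detour_index_inj p (d d' : detour_index p) : d_arrow d = d_arrow d' ->
  d_path d = d_path d' -> plength (d_target d) = plength (d_target d') -> d = d'.
Proof.
move=> ea eu el; apply: val_inj.
have et : d_target d = d_target d'.
  case: (detour_targetsP (d_targetP d)) => -> _ _.
  by case: (detour_targetsP (d_targetP d')) => -> _ _; rewrite el.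
move: ea eu et; rewrite /d_arrow /d_path /d_target.
case: (val d) => [[a u] v]; case: (val d') => [[a' u'] v'] /= -> eu ev.
by rewrite (val_inj eu) (val_inj ev).
Qed.

(* Without double arrows the first arrow after [u] on [p] is the only arrow
   between its end points. *)
Lemma detour_target_gt p (d : detour_index p) :
  (forall a b : arrow Q, source a = source b -> target a = target b -> a = b) ->
  ((plength (d_path d)).+1 < plength (d_target d))%N.
Proof.
move=> nd; have [ve /andP[lt le] vt] := detour_targetsP (d_targetP d).
rewrite ltn_neqAle lt andbT; apply/eqP => el.
have /and3P[ui + _] := d_detour d.
have [ue _] := rsubpaths_rsub ui.
set a := d_arrow d; set u := d_path d in ue el ui *.
case c: (pcomp (apath a) u) => [r|] //= /negP; apply.
suff -> : r = d_target d by rewrite ve; apply: rsub_in.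
case/pcompP: c => ut rs ra.
have up : (plength u < plength p)%N by rewrite el.
pose b := nth a (parrows p) (plength u).
have vr : parrows (d_target d) = rcons (parrows u) b.
  by rewrite ve ue -el /= /parrows /= (take_nth a) // plength_rsub // ltnW.
have vs : psource (d_target d) = psource u by rewrite ve ue.
have ab : a = b; last by apply: qpath_eq; rewrite ?rs ?ra // vr -ab cats1.
apply: nd; last by rewrite -/a in vt; rewrite -vt /ptarget vr map_rcons last_rcons.
have := qpath_walk (d_target d); rewrite vs vr -cats1 is_walk_cat /= andbT.
by case/andP=> _ /eqP ->; rewrite -/(ptarget u) ut.
Qed.

Lemma detour_notin p a u : detour p a u ->
  prefix (rcons (parrows u) a) (parrows p) -> False.
Proof.
case/and3P=> /rsubpaths_rsub[ue _] + _ pr.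
case c: (pcomp (apath a) u) => [r|] //= /negP; apply.
suff -> : r = rsub p (plength u).+1 by apply: rsub_in.
case/pcompP: c => ut rs ra.
apply: qpath_eq; first by rewrite rs ue.
case/prefixP: pr => s e.
by rewrite ra -[RHS]/(take (size _).+1 (parrows p)) e -(size_rcons _ a)
   take_size_cat // cats1.
Qed.

(* [p] deviates from being periodic with period [w] for the first time after
   [u w], so [w] determines [(a, u)]. *)
Lemma detour_index_period p (d d' : detour_index p) (s : seq (arrow Q)) :
  parrows (d_target d) = s ++ rcons (parrows (d_path d)) (d_arrow d) ->
  parrows (d_target d') = s ++ rcons (parrows (d_path d')) (d_arrow d') ->
  d = d'.
Proof.
wlog le : d d' / (plength (d_path d) <= plength (d_path d'))%N.
  move=> H e e'; have [le|le] := leqP (plength (d_path d)) (plength (d_path d')).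
    exact: H.
  by apply/esym/H => //; apply: ltnW.
move=> e e'.
have [ve _ _] := detour_targetsP (d_targetP d).
have [ve' /andP[_ le'] _] := detour_targetsP (d_targetP d').
have [ue lu] := rsubpaths_rsub (detour_src (d_detour d)).
have [ue' _] := rsubpaths_rsub (detour_src (d_detour d')).
have tk : parrows (d_target d) = take (plength (d_target d)) (parrows (d_target d')).
  rewrite {1}ve ve' /= /parrows /= take_takel //.
  by rewrite /plength e e' !size_cat !size_rcons leq_add2l ltnS.
move: tk; rewrite {1}e /plength e e' size_cat take_cat ltnNge leq_addr /= addKn.
move/eqP; rewrite eqseq_cat // eqxx /= => /eqP tk.
(* If [d_path d] were strictly shorter, its extension by [d_arrow d] would be a prefix of
   [d_path d'], hence of [p], which [detour_notin] forbids. *)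
move: le; rewrite leq_eqVlt => /orP[/eqP eq|lt]; last first.
  case: (detour_notin (d_detour d)).
  move: tk; rewrite -[in X in _ = take _ X]cats1 takel_cat ?size_rcons // => ->.
  rewrite ue' /= /parrows /= -/(parrows p).
  apply/prefixP; exists (
    drop (plength (d_path d)).+1 (take (plength (d_path d')) (parrows p)) ++
    drop (plength (d_path d')) (parrows p)).
  by rewrite catA cat_take_drop cat_take_drop.
have /rcons_inj[ea ed] :
    rcons (parrows (d_path d)) (d_arrow d) = rcons (parrows (d_path d')) (d_arrow d').
  by rewrite tk take_oversize // !size_rcons -[size _]/(plength (d_path d')) -eq.
apply: detour_index_inj => //.
  by rewrite ue ue' eq.
by rewrite /plength e e' ea ed.
Qed.

End Paths.

(** * The path algebra and its action *)

(* Locked: unification must not try to decide equality of scalar multiples by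
   unfolding them to finitely supported functions. *)
HB.lock Definition pscalar (K : fieldType) (Q : quiver) (c : K) : pathalg K Q :=
  c *: (1 : pathalg K Q).

Arguments pscalar {K} Q c.

Local Notation "c %:S" := (pscalar _ c) 
  (at level 2, left associativity, format "c %:S").

Section PathAlgebra.
Set Implicit Arguments.
Unset Strict Implicit.
Variables (K : fieldType) (Q : quiver).
Implicit Types (a b : pathalg K Q) (p q u v w : qpath Q).

Lemma pscalarE c a : c *: a = c%:S * a.
Proof. by rewrite unlock -pathalg_scaleAl mul1r. Qed.

Lemma pscalarC c a : a * c%:S = c%:S * a.
Proof. by rewrite -pscalarE unlock -pathalg_scaleAr mulr1. Qed.

Fact pscalar_is_zmod_morphism : zmod_morphism (@pscalar K Q).
Proof. by move=> c d; rewrite !unlock scalerBl. Qed.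

Fact pscalar_is_monoid_morphism : monoid_morphism (@pscalar K Q).
Proof.
split=> [|c d]; first by rewrite unlock scale1r.
by rewrite -pscalarE !unlock scalerA.
Qed.

HB.instance Definition _ := GRing.isZmodMorphism.Build K (pathalg K Q)
  (@pscalar K Q) pscalar_is_zmod_morphism.
HB.instance Definition _ := GRing.isMonoidMorphism.Build K (pathalg K Q)
  (@pscalar K Q) pscalar_is_monoid_morphism.

Lemma pathalg_ind (P : pathalg K Q -> Prop) :
  P 0 -> (forall a b, P a -> P b -> P (a + b)) ->
  (forall c q, P (c%:S * pbasis K q)) -> forall a, P a.
Proof.
move=> P0 PD PU a; rewrite (pathalgE a); apply: big_ind => // q _.
by rewrite pscalarE.
Qed.

Lemma pbasis_pcomp q u v : pcomp q u = Some v ->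
  pbasis K v = pbasis K q * pbasis K u.
Proof. by rewrite pbasisM => ->. Qed.

Lemma pbasis_pcompN q u : pcomp q u = None -> pbasis K q * pbasis K u = 0.
Proof. by rewrite pbasisM => ->. Qed.

Lemma pbasis_neq0 q : pbasis K q <> 0.
Proof.
move=> e; have := pcoef_basis K q q; rewrite e -(scale0r (0 : pathalg K Q)).
by rewrite pcoefZ mul0r eqxx => /esym/eqP; rewrite oner_eq0.
Qed.

Lemma pbasis_inj : injective (@pbasis K Q).
Proof.
move=> q u e; have := pcoef_basis K q u; rewrite e pcoef_basis eqxx.
by case: eqP => // _ /eqP; rewrite oner_eq0.
Qed.

(** Basis elements are nonzero and distinct, so an identity in the path algebra such as
    [v = alpha u w] can be read as one between paths. *)
Lemma pbasisM_some q u v : pbasis K v = pbasis K q * pbasis K u ->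
  pcomp q u = Some v.
Proof.
rewrite pbasisM; case: (pcomp q u) => [r /pbasis_inj -> //|/pbasis_neq0 []].
Qed.

Lemma vpath_pbasis e q :
  pbasis K (vpath e) * pbasis K q = if ptarget q == e then pbasis K q else 0.
Proof.
case: eqP => [<-|ne]; last by apply/pbasis_pcompN/pcompN.
by apply/esym/pbasis_pcomp/pcompP; rewrite cats0.
Qed.

Lemma pbasis_vpath e q :
  pbasis K q * pbasis K (vpath e) = if psource q == e then pbasis K q else 0.
Proof.
case: eqP => [<-|ne]; last by apply/pbasis_pcompN/pcompN => /esym.
by apply/esym/pbasis_pcomp/pcompP.
Qed.

Lemma rsub_suffix p j : (j <= plength p)%N ->
  exists2 v, plength v = (plength p - j)%N &
             pbasis K p = pbasis K v * pbasis K (rsub p j).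
Proof.
move=> jp; have /rsubpathP[v e] := rsub_in p j.
exists v; last exact: pbasis_pcomp.
by rewrite (plength_pcomp e) plength_rsub // addKn.
Qed.

(** Applied to a top element, this is the expansion in the basis of the [v x], with [v] indexed by
    its length; values of [c] beyond [plength p] do not matter. *)
Definition comb p (c : nat -> K) : pathalg K Q :=
  \sum_(j < (plength p).+1) (c j)%:S * pbasis K (rsub p j).

Lemma combD p c c' : comb p c + comb p c' = comb p (fun j => c j + c' j).
Proof. by rewrite -big_split; apply: eq_bigr => j _; rewrite rmorphD mulrDl. Qed.

Lemma combZ p k c : k%:S * comb p c = comb p (fun j => k * c j).
Proof. by rewrite mulr_sumr; apply: eq_bigr => j _; rewrite mulrA rmorphM. Qed.

Lemma comb0 p : comb p (fun=> 0) = 0.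
Proof. by apply: big1 => j _; rewrite rmorph0 mul0r. Qed.

Lemma combB p c c' : comb p c - comb p c' = comb p (fun j => c j - c' j).
Proof. by rewrite /comb -sumrB; apply: eq_bigr => j _; rewrite rmorphB mulrBl. Qed.

Lemma comb1 p i : (i <= plength p)%N ->
  comb p (fun j => (j == i)%:R) = pbasis K (rsub p i).
Proof.
move=> ip; rewrite /comb (bigD1 (Ordinal (ip : (i < (plength p).+1)%N))) //=.
rewrite eqxx rmorph1 mul1r big1 ?addr0 // => j.
by rewrite -val_eqE /= => /negbTE ->; rewrite rmorph0 mul0r.
Qed.

Lemma eq_comb p c c' : (forall j, (j <= plength p)%N -> c j = c' j) ->
  comb p c = comb p c'.
Proof. by move=> e; apply: eq_bigr => j _; rewrite e // -ltnS. Qed.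

Lemma vpath_comb p e c : pbasis K (vpath e) * comb p c =
  comb p (fun j => if ptarget (rsub p j) == e then c j else 0).
Proof.
rewrite mulr_sumr; apply: eq_bigr => j _; rewrite mulrA pscalarC -mulrA vpath_pbasis.
by case: ifP => _; rewrite ?rmorph0 ?mulr0 // mul0r.
Qed.

(** In the last case no coordinate is recorded: the product will annihilate [x], because no longer
    right subpath ends where [a] ends. *)
Lemma apath_rsub p (a : arrow Q) j : (j <= plength p)%N ->
  [\/ pbasis K (apath a) * pbasis K (rsub p j) = 0,
      (j < plength p)%N /\
        pbasis K (apath a) * pbasis K (rsub p j) = pbasis K (rsub p j.+1),
      detour p a (rsub p j)
    | pcomp (apath a) (rsub p j) <> None /\ detour_targets p a (rsub p j) = [::]].
Proof.
move=> jp; case c: (pcomp (apath a) (rsub p j)) => [r|]; last first.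
  by apply: Or41; apply: pbasis_pcompN.
have [rp|rp] := boolP (r \in rsubpaths p).
  have [re rl] := rsubpaths_rsub rp; have := plength_pcomp c.
  rewrite plength_rsub // [plength (apath a)]/= addn1 => e.
  by apply: Or42; split; rewrite -?(pbasis_pcomp c) -?e -?re.
have [e|ne] := eqVneq (detour_targets p a (rsub p j)) [::].
  by apply: Or44.
by apply: Or43; rewrite /detour rsub_in c ne andbT.
Qed.

End PathAlgebra.

Section Action.
Set Implicit Arguments.
Unset Strict Implicit.
Variables (K : fieldType) (Q : quiver) (I : idealType (pathalg K Q)).
Variable (M : lmodType (qalgebra I)).
Implicit Types (a b : pathalg K Q) (x y : M) (S : {pred M}).

Lemma pactDl a b x : pact (a + b) x = pact a x + pact b x.
Proof. by rewrite /pact rmorphD scalerDl. Qed.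

Lemma pactBl a b x : pact (a - b) x = pact a x - pact b x.
Proof. by rewrite /pact rmorphB scalerBl. Qed.

Lemma pact0l x : pact (0 : pathalg K Q) x = 0.
Proof. by rewrite /pact rmorph0 scale0r. Qed.

Lemma pactDr a x y : pact a (x + y) = pact a x + pact a y.
Proof. exact: scalerDr. Qed.

Lemma pactBr a x y : pact a (x - y) = pact a x - pact a y.
Proof. exact: scalerBr. Qed.

Lemma pact0r a : pact a (0 : M) = 0.
Proof. exact: scaler0. Qed.

Lemma pactM a b x : pact (a * b) x = pact a (pact b x).
Proof. by rewrite /pact rmorphM scalerA. Qed.

Lemma pact1 x : pact (1 : pathalg K Q) x = x.
Proof. by rewrite /pact rmorph1 scale1r. Qed.

Lemma pact_sum (J : finType) (P : pred J) (f : J -> pathalg K Q) x :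
  pact (\sum_(i | P i) f i) x = \sum_(i | P i) pact (f i) x.
Proof.
by apply: (big_morph (fun a => pact a x) _ (pact0l x)) => a b; apply: pactDl.
Qed.

Section Closed.
Variable S : {pred M}.
Hypothesis Ssub : submod_closed S.

Lemma submod0 : 0 \in S. Proof. by case: Ssub. Qed.

Lemma submodD x y : x \in S -> y \in S -> x + y \in S.
Proof. by case: Ssub => _ c xS yS; rewrite -[x]scale1r; apply: c. Qed.

Lemma submodA a x : x \in S -> pact a x \in S.
Proof. by case: Ssub => c0 c xS; rewrite -[pact _ _]addr0; apply: c. Qed.

Lemma submodB x y : x \in S -> y \in S -> x - y \in S.
Proof. by case: Ssub => _ c xS yS; rewrite -scaleN1r addrC; apply: c. Qed.

Lemma submodZ c x : c != 0 -> pact (pscalar Q c) x \in S -> x \in S.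
Proof.
move=> c0 /(submodA (pscalar Q c^-1)).
by rewrite -pactM -rmorphM /= mulVf // rmorph1 pact1.
Qed.

End Closed.

(** Scalars of the quotient lift to the path algebra, so stability under [pact] suffices. *)
Lemma pact_submod_closed (P : M -> Prop) :
  P 0 -> (forall x y, P x -> P y -> P (x + y)) ->
  (forall a x, P x -> P (pact a x)) ->
  submod_closed (fun x => boolp.asbool (P x) : bool).
Proof.
move=> P0 PD PA; split; first by apply/boolp.asboolP.
move=> r x y /boolp.asboolP xP /boolp.asboolP yP; apply/boolp.asboolP.
by have [a <-] := rquot_surj r; apply: PD => //; apply: PA.
Qed.

End Action.

(** * The composition series as a filtration *)

Section Radical.
Set Implicit Arguments.
Unset Strict Implicit.
Variables (K : fieldType) (Q : quiver) (I : idealType (pathalg K Q)).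
Variable (M : lmodType (qalgebra I)).

(** For [y] outside the maximal submodule [N], the left ideal of scalars sending [y] into [N] is
    maximal, so it contains the radical. *)
Lemma in_radical_maximal (N T : {pred M}) (x : M) : submod_closed N ->
  T =i predT -> simple_step N T -> in_radical x -> x \in N.
Proof.
move=> Ns TT [_ NT Nmax] [n [j [y [jJ ->]]]].
have [N0 Nlin] := Ns.
suff jy i : j i *: y i \in N.
  by apply: (big_ind (fun z => z \in N)) => // u v; apply: submodD.
have [yN|yN] := boolP (y i \in N).
  by rewrite -[_ *: _]addr0; apply: Nlin.
pose L : {pred (qalgebra I)^o} := fun r => (r : qalgebra I) *: y i \in N.
apply: (jJ i L); split.
  split; first by rewrite unfold_in /L scale0r.
  by move=> r u v uL vL; rewrite unfold_in /L scalerDl -scalerA; apply: Nlin.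
split=> //; first by move=> H; have := H 1 isT;
  rewrite unfold_in /L scale1r (negbTE yN).
move=> S [S0 Slin] LS _.
have [SL|/boolp.existsNP[a]] := boolp.EM {subset S <= L}; first by left.
case/boolp.not_implyP => aS aL; right=> b _.
(* [N' = N + S y] contains [a y], which is not in [N], so it is everything. From [y - r y] in [N]
   with [r] in [S] one gets [1 - r] in [L], hence [1] in [S]. *)
pose N' : {pred M} :=
  fun z => boolp.asbool (exists2 r : qalgebra I, r \in S & z - r *: y i \in N).
have N's : submod_closed N'.
  split; first by apply/boolp.asboolP; exists 0; rewrite // scale0r subr0.
  move=> r u v /boolp.asboolP[s sS su] /boolp.asboolP[t tS tv].
  apply/boolp.asboolP; exists (r * s + t); first exact: (Slin r s t).
  by rewrite scalerDl -scalerA opprD addrACA -scalerBr; apply: Nlin.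
case: (Nmax N' N's).
- by move=> z zN; apply/boolp.asboolP; exists 0; rewrite // scale0r subr0.
- by move=> z _; rewrite TT.
- move=> /(_ (a *: y i)) H; case: aL; apply: H; apply/boolp.asboolP.
  by exists a; rewrite // subrr.
move=> /(_ (y i)); rewrite TT => /(_ isT) /boolp.asboolP[r rS rN].
have S1 : (1 : (qalgebra I)^o) \in S.
  have : (1 - r : (qalgebra I)^o) \in S.
    by apply: LS; rewrite unfold_in /L scalerBl scale1r.
  by move/(Slin 1 _ r); rewrite scale1r subrK; apply.
by have := Slin b 1 0 S1 S0; rewrite addr0 [b *: _]mulr1.
Qed.

End Radical.

Section Filtration.
Set Implicit Arguments.
Unset Strict Implicit.
Variables (K : fieldType) (Q : quiver) (I : idealType (pathalg K Q)).
Hypothesis I_adm : admissible I.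
Variables (M : lmodType (qalgebra I)) (p : qpath Q).
Implicit Types (a b : pathalg K Q) (x y : M) (q u v : qpath Q) (c : nat -> K).

(** The composition series numbered downwards, with [F i] in the role of [J^i M], and continued by
    zero so that a path of length [l] shifts the index by [l] without exceptions. *)
Definition composition_filtration (F : nat -> {pred M}) : Prop :=
  [/\ forall i, submod_closed (F i), F 0 =i predT,
      forall i, (plength p < i)%N -> F i =i pred1 0
    & forall i, (i <= plength p)%N -> simple_step (F i.+1) (F i)].

Lemma filtration_exists : mast_of M p -> exists F, composition_filtration F.
Proof.
case=> _ [N [N0 Nl Ns Nst]] _; exists (fun i => N ((plength p).+1 - i)%N); split.
- by move=> i; apply: Ns; rewrite leq_subr.
- by rewrite subn0.
- by move=> i lt; move: (lt); rewrite -subn_eq0 => /eqP ->.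
- by move=> i le; rewrite subSS subSn //; apply: Nst; rewrite ltnS leq_subr.
Qed.

(** A form of top element that is easy to test after changing [x]; [cyclic_top_element] leads back
    to the radical. *)
Definition cyclic_top x : Prop :=
  pact (pbasis K (vpath (psource p))) x = x /\ pact (pbasis K p) x <> 0.

Lemma cyclic_top_exists : mast_of M p -> exists x, cyclic_top x.
Proof.
case=> _ _ [x px]; exists (pact (pbasis K (vpath (psource p))) x).
by split; rewrite -pactM pbasis_vpath eqxx.
Qed.

Variable F : nat -> {pred M}.
Hypothesis FF : composition_filtration F.

Let Fsub i : submod_closed (F i). Proof. by case: FF. Qed.
Let FT x : x \in F 0. Proof. by case: FF => _ ->. Qed.
Let F0 i : (plength p < i)%N -> F i =i pred1 0.
Proof. by case: FF => _ _ + _; apply. Qed.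
Let Fstep i : (i <= plength p)%N -> simple_step (F i.+1) (F i).
Proof. by case: FF => _ _ _; apply. Qed.
Let F_0 i : 0 \in F i. Proof. exact: submod0. Qed.

Lemma filtration_anti i j x : (i <= j)%N -> x \in F j -> x \in F i.
Proof.
move=> ij; rewrite -(subnK ij); elim: (j - i)%N => // n IH; rewrite addSn => xF.
apply: IH; have [le|lt] := leqP (n + i) (plength p).
  by case: (Fstep le) => + _ _; apply.
by move: xF; rewrite F0 ?ltnS ?(ltnW lt) // => /eqP ->.
Qed.

(* Nakayama: were [q] of positive length to act nontrivially on the simple
   quotient [F i / F i.+1], arbitrarily long paths would. *)
Lemma filtration_path1 i q x : (0 < plength q)%N -> x \in F i ->
  pact (pbasis K q) x \in F i.+1.
Proof.
move=> q0 xF; have [le|lt] := leqP i (plength p); last first.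
  by move: xF; rewrite F0 // => /eqP ->; rewrite pact0r.
have [_ [m _ Im]] := I_adm.
(* [P] defines a submodule between [F i.+1] and [F i]; by simplicity it is one of the two, and it
   has to be [F i]. *)
pose P y := y \in F i /\
  forall q, (0 < plength q)%N -> pact (pbasis K q) y \in F i.+1.
have Ps : submod_closed (fun x => boolp.asbool (P x) : bool).
  apply: pact_submod_closed.
  - by split=> // v _; rewrite pact0r.
  - move=> y z [yF yP] [zF zP]; split; first exact: (submodD (Fsub _)).
    by move=> v v0; rewrite pactDr; apply: (submodD (Fsub _)) => //;
      [apply: yP | apply: zP].
  - move=> a y [yF yP]; split; first exact: (submodA (Fsub _)).
    move=> v v0; elim/pathalg_ind: a => [|a b aF bF|c u].
    + by rewrite pact0l pact0r.
    + by rewrite pactDl pactDr; apply: (submodD (Fsub _)).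
    rewrite -pactM mulrA pscalarC -mulrA; case e: (pcomp v u) => [w|]; last first.
      by rewrite (pbasis_pcompN _ e) mulr0 pact0l.
    rewrite -(pbasis_pcomp _ e) pactM.
    by apply: (submodA (Fsub _)) => //; apply: yP; rewrite (plength_pcomp e) ltn_addl.
case: (Fstep le) => sF nF; case/(_ _ Ps).
- move=> y yF; apply/boolp.asboolP; split; first exact: sF.
  by move=> v _; apply: (submodA (Fsub _)).
- by move=> y /boolp.asboolP[].
(* Were it [F i.+1], every element outside [F i.+1] could be moved by a path of positive length to
   another such element, whereas admissibility kills all long paths. *)
- move=> PF; case: nF => y yF; apply: boolp.contrapT => nyF.
  have long n : exists2 v, (n <= plength v)%N & pact (pbasis K v) y \in F i /\
      pact (pbasis K v) y \notin F i.+1.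
    elim: n => [|n [v vn [vF nvF]]].
      have [e eF] : exists e, pact (pbasis K (vpath e)) y \notin F i.+1.
        apply: boolp.contrapT => H; case: nyF.
        rewrite -(pact1 y) [1]/(pathalg_one K Q) /pathalg_one pact_sum.
        apply: (big_ind (fun z => z \in F i.+1)) => [//|u v|e _].
          exact: (submodD (Fsub _)).
        by apply: boolp.contrapT => /negP H'; apply: H; exists e.
      by exists (vpath e) => //; split=> //; apply: (submodA (Fsub _)).
    have [u [u0 uF]] : exists u, (0 < plength u)%N /\
        pact (pbasis K u) (pact (pbasis K v) y) \notin F i.+1.
      apply: boolp.contrapT => H; case/negP: nvF; apply: PF.
      apply/boolp.asboolP; split=> // u u0; apply: boolp.contrapT => /negP H'.
      by apply: H; exists u.
    move: uF; rewrite -pactM; case e: (pcomp u v) => [w|]; last first.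
      by rewrite (pbasis_pcompN _ e) pact0l F_0.
    rewrite -(pbasis_pcomp _ e) => wF; exists w; last first.
      by split=> //; apply: (submodA (Fsub _)).
    by rewrite (plength_pcomp e) -addn1 leq_add.
  have [v mv [_]] := long m; rewrite /pact.
  have /eqP -> : rquot I (pbasis K v) == 0.
    rewrite rquot_eq0; apply: Im => u; rewrite pcoef_basis.
    by case: (v =P u) => [<- //|_]; rewrite eqxx.
  by rewrite scale0r F_0.
- by move/(_ _ xF)/boolp.asboolP => [_]; apply.
Qed.

Lemma filtration_path i q x : x \in F i ->
  pact (pbasis K q) x \in F (i + plength q)%N.
Proof.
move=> xF; elim/qpath_ind: q => [e|a u q IH e].
  by rewrite addn0; apply: (submodA (Fsub _)).
rewrite (pbasis_pcomp _ e) pactM (plength_pcomp e) [plength (apath a)]/= addn1 addnS.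
exact: filtration_path1.
Qed.

(** * The basis formed by the right subpaths of [p] applied to a top element *)

Section Top.
Variable x : M.
Hypothesis xtop : cyclic_top x.

(** If [rsub p j] sent [x] one step too deep, the rest of [p] would carry it on to zero,
    contradicting [p x <> 0]. *)
Lemma rsub_filtration j : (j <= plength p)%N ->
  pact (pbasis K (rsub p j)) x \in F j /\
  pact (pbasis K (rsub p j)) x \notin F j.+1.
Proof.
move=> jp; split.
  by have := filtration_path (rsub p j) (FT x); rewrite plength_rsub.
apply/negP => bF; case: xtop => _ px; case: px.
have [v vl ->] := rsub_suffix K jp.
have := filtration_path v bF; rewrite vl addSn subnKC // F0 // => /eqP.
by rewrite pactM.
Qed.

Lemma cyclic_top_element : top_element x.
Proof.
split; last by exists (psource p); case: xtop.
have [_] := rsub_filtration (leq0n _); rewrite rsub0; case: xtop => -> _.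
move/negP=> xF xr; apply: xF.
by apply: (in_radical_maximal (T := F 0)) xr => //; apply: Fstep.
Qed.

(** Paths of positive length kill the layer [F i / F i.+1] and vertices act on the class of [b x] by
    0 or 1. Its K-span is therefore a nonzero submodule, which by simplicity is the whole layer. *)
Lemma filtration_top i y : (i <= plength p)%N -> y \in F i ->
  exists k : K, y - pact (k%:S * pbasis K (rsub p i)) x \in F i.+1.
Proof.
move=> ip yF; set b := pbasis K (rsub p i).
have [bF nbF] := rsub_filtration ip; rewrite -/b in bF nbF.
pose P z := exists k : K, z - pact (k%:S * b) x \in F i.+1.
have P0 : P 0 by exists 0; rewrite rmorph0 mul0r pact0l subr0.
have PD z w : P z -> P w -> P (z + w).
  case=> [k kF] [l lF]; exists (k + l).
  by rewrite rmorphD mulrDl pactDl opprD addrACA; apply: (submodD (Fsub _)) kF lF.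
have PS k z : P z -> P (pact k%:S z).
  case=> l lF; exists (k * l); rewrite rmorphM -mulrA [pact (_ * _) _]pactM -pactBr.
  exact: (submodA (Fsub _) _ lF).
have PF z : z \in F i.+1 -> P z.
  by move=> zF; exists 0; rewrite rmorph0 mul0r pact0l subr0.
have Pb q : P (pact (pbasis K q) (pact b x)).
  have [q0|q0] := posnP (plength q); last exact/PF/filtration_path1.
  have -> : q = vpath (psource q) by apply: qpath_eq => //; move/size0nil: q0.
  rewrite -pactM vpath_pbasis; case: ifP => _; last by rewrite pact0l.
  by exists 1; rewrite rmorph1 mul1r subrr.
have Ps : submod_closed (fun x => boolp.asbool (P x) : bool).
  apply: pact_submod_closed => // a z [k kF].
  rewrite -(subrK (pact (k%:S * b) x) z) pactDr; apply: (PD).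
    exact/PF/(submodA (Fsub _) _ kF).
  rewrite -pactM mulrA pscalarC -mulrA pactM; apply: (PS k); rewrite pactM.
  elim/pathalg_ind: a => [|a1 a2 H1 H2|l q]; first by rewrite pact0l.
    by rewrite pactDl; apply: (PD) H1 H2.
  by rewrite pactM; apply: PS.
pose S : {pred M} := fun z => boolp.asbool (P z /\ z \in F i).
have Ss : submod_closed S.
  case: Ps => _ Plin; split.
    by apply/boolp.asboolP; split=> //; apply/boolp.asboolP.
  move=> r z w /boolp.asboolP[zP zF] /boolp.asboolP[wP wF].
  apply/boolp.asboolP; split; first by apply/boolp.asboolP/Plin; apply/boolp.asboolP.
  by case: (Fsub i) => _; apply.
case: (Fstep ip) => sF _ /(_ _ Ss) [].
- move=> z zF; apply/boolp.asboolP; split; last exact: sF.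
  exact: PF.
- by move=> z /boolp.asboolP[].
- move/(_ (pact b x)) => H; case/negP: nbF; apply: H; apply/boolp.asboolP.
  by split=> //; exists 1; rewrite rmorph1 mul1r subrr.
- by move/(_ _ yF)/boolp.asboolP => [].
Qed.

(** One coefficient is found in each layer, by induction on the number of layers left. *)
Lemma filtration_comb i y : y \in F i ->
  exists2 c, (forall j, (j < i)%N -> c j = 0) & y = pact (comb p c) x.
Proof.
have [n] := ubnP ((plength p).+1 - i)%N; elim: n i y => // n IH i y lt yF.
have [ip|ip] := leqP i (plength p); last first.
  move: yF; rewrite F0 // => /eqP ->.
  by exists (fun=> 0); rewrite // comb0 pact0l.
have [k kF] := filtration_top ip yF.
have [|c c0 e] := IH i.+1 _ _ kF.
  by move: lt; rewrite subSS subSn.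
exists (fun j => c j + k * (j == i)%:R).
  by move=> j ji; rewrite c0 ?leqW // add0r ltn_eqF // mulr0.
by rewrite -combD pactDl -e -combZ comb1 // subrK.
Qed.

(** Triangularity: the first nonzero coefficient, at [j < i], would force [rsub p j] to send [x]
    into [F j.+1]. *)
Lemma comb_filtration i c : pact (comb p c) x \in F i ->
  forall j, (j <= plength p)%N -> (j < i)%N -> c j = 0.
Proof.
move=> cF j; elim/ltn_ind: j => j IH jp ji.
apply/eqP/negPn/negP => cj; have [_ /negP] := rsub_filtration jp; apply.
apply: (submodZ (Fsub _) cj) => //.
(* The term at [j] is the whole sum minus its tail beyond [j], the earlier coefficients being zero
   by induction. *)
have -> : pact (c j)%:S (pact (pbasis K (rsub p j)) x) =
   pact (comb p c) x - pact (comb p (fun h => if (h <= j)%N then 0 else c h)) x.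
  rewrite -pactM -pactBl combB -(comb1 K jp) combZ; congr pact; apply: eq_comb => h hp.
  have [hj|hj|->] := ltngtP h j; rewrite ?subr0 ?subrr ?mulr0 ?mulr1 //.
  by rewrite IH //; apply: ltn_trans ji.
apply: (submodB (Fsub _)) => //; first exact: filtration_anti cF.
rewrite /comb pact_sum; apply: (big_ind (fun z => z \in F j.+1)) => //.
  by move=> u v; apply: (submodD (Fsub _)).
move=> h _; case: leqP => hj; first by rewrite rmorph0 mul0r pact0l.
have [hF _] := rsub_filtration (ltn_ord h : (h <= plength p)%N).
by rewrite pactM; apply: (submodA (Fsub _)); apply: filtration_anti hF.
Qed.

Lemma comb_inj c c' : pact (comb p c) x = pact (comb p c') x ->
  forall j, (j <= plength p)%N -> c j = c' j.
Proof.
move=> e j jp; apply/eqP; rewrite -subr_eq0; apply/eqP.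
apply: (@comb_filtration (plength p).+1 (fun j => c j - c' j)) => //.
by rewrite -combB pactBl e subrr.
Qed.

End Top.
End Filtration.

(** * Coordinates of a top element *)

Section Coordinates.
Set Implicit Arguments.
Unset Strict Implicit.
Variables (K : fieldType) (Q : quiver) (I : idealType (pathalg K Q)).
Hypothesis I_adm : admissible I.
Variable (p : qpath Q).
Implicit Types (M N : lmodType (qalgebra I)) (u v w : qpath Q) (c : nat -> K).
Implicit Types (k : detour_index p -> K).

Definition detour_coords M (x : M) k : Prop :=
  forall (a : arrow Q) u, detour p a u ->
    pact (pbasis K (apath a) * pbasis K u) x
    = \sum_(d : detour_index p | (d_arrow d == a) && (d_path d == u))
        pact (k d *: pbasis K (d_target d)) x.

(** The coordinates of one detour, re-indexed by the length of the target for use with [comb]; the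
    sum has at most one term. *)
Definition kcoef k (a : arrow Q) u (j : nat) : K :=
  \sum_(d : detour_index p | [&& d_arrow d == a, d_path d == u
                              & plength (d_target d) == j]) k d.

Lemma kcoef_index k d :
  kcoef k (d_arrow d) (d_path d) (plength (d_target d)) = k d.
Proof.
rewrite /kcoef (bigD1 d) ?eqxx //= big1 ?addr0 // => d'.
case/andP=> /and3P[/eqP ea /eqP eu /eqP el] /eqP[].
exact: detour_index_inj.
Qed.

Lemma kcoef_out k (a : arrow Q) u j : (j <= plength p)%N ->
  rsub p j \notin detour_targets p a u -> kcoef k a u j = 0.
Proof.
move=> jp nt; apply: big1 => d /and3P[/eqP ea /eqP eu /eqP el].
case/negP: nt; rewrite -el; have := d_targetP d; rewrite ea eu => dt.
by have [<-] := detour_targetsP dt.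
Qed.

Lemma comb_kcoef k (a : arrow Q) u :
  comb p (kcoef k a u) =
  \sum_(d : detour_index p | (d_arrow d == a) && (d_path d == u))
    (k d)%:S * pbasis K (d_target d).
Proof.
have tle (d : detour_index p) : (plength (d_target d) < (plength p).+1)%N.
  by have [_ /andP[_ le] _] := detour_targetsP (d_targetP d).
rewrite (partition_big (fun d => Ordinal (tle d)) xpredT) //=.
apply: eq_bigr => j _; rewrite rmorph_sum mulr_suml; apply: eq_big => d.
  by rewrite -andbA -val_eqE.
case/and3P=> _ _ /eqP <- /=.
by have [<- _ _] := detour_targetsP (d_targetP d).
Qed.

Lemma detour_coordsP M (x : M) k :
  detour_coords x k <-> forall (a : arrow Q) u, detour p a u ->
    pact (pbasis K (apath a) * pbasis K u) x = pact (comb p (kcoef k a u)) x.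
Proof.
have e (a : arrow Q) u : pact (comb p (kcoef k a u)) x =
    \sum_(d : detour_index p | (d_arrow d == a) && (d_path d == u))
        pact (k d *: pbasis K (d_target d)) x.
  by rewrite comb_kcoef pact_sum; apply: eq_bigr => d _; rewrite pscalarE.
by split=> H a u dt; rewrite H ?e.
Qed.

Section Existence.
Variables (M : lmodType (qalgebra I)) (F : nat -> {pred M}).
Hypothesis FF : composition_filtration p F.
Variable x : M.
Hypothesis xtop : cyclic_top p x.

(** The element lies in [F i.+1] and is fixed by the end vertex of [a], so only longer right
    subpaths ending in that vertex contribute. *)
Lemma apath_rsub_comb (a : arrow Q) i : (i <= plength p)%N ->
  exists2 c, (forall j, (j <= plength p)%N ->
                rsub p j \notin detour_targets p a (rsub p i) -> c j = 0)
    & pact (pbasis K (apath a) * pbasis K (rsub p i)) x = pact (comb p c) x.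
Proof.
move=> ip; have yF : pact (pbasis K (apath a) * pbasis K (rsub p i)) x \in F i.+1.
  have [bF _] := rsub_filtration I_adm FF xtop ip.
  by have := filtration_path I_adm FF (apath a) bF; rewrite addn1 pactM.
have [c c0 e] := filtration_comb I_adm FF xtop yF.
exists (fun j => if ptarget (rsub p j) == target a then c j else 0).
  move=> j jp; rewrite mem_filter rsub_in andbT !plength_rsub //.
  by case: ifP => // _; rewrite andbT -leqNgt -ltnS => /c0.
rewrite -vpath_comb [RHS]pactM -e -pactM mulrA vpath_pbasis.
by rewrite /ptarget /= eqxx.
Qed.

Lemma detour_coords_exist : exists k, detour_coords x k.
Proof.
pose P (au : arrow Q * qpath Q) c := detour p au.1 au.2 ->
  (forall j, (j <= plength p)%N ->
     rsub p j \notin detour_targets p au.1 au.2 -> c j = 0) /\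
  pact (pbasis K (apath au.1) * pbasis K au.2) x = pact (comb p c) x.
have [[a u]|c cP] := @boolp.choice _ _ P.
  (* Pairs that are not detours receive the default zero. *)
  have [dt|/negP ndt] := boolP (detour p a u); last by exists (fun=> 0).
  have [ue ul] := rsubpaths_rsub (detour_src dt).
  have [c c0 ce] := apath_rsub_comb a ul; exists c => _ /=.
  by rewrite ue.
exists (fun d => c (d_arrow d, d_path d) (plength (d_target d))).
apply/detour_coordsP => a u dt; have [c0 ->] := cP (a, u) dt.
congr pact; apply: eq_comb => j jp.
have [jt|jt] := boolP (rsub p j \in detour_targets p a u); last first.
  by rewrite kcoef_out // c0.
have [d [da du de]] := detour_indexP dt jt.
have := kcoef_index (fun d => c (d_arrow d, d_path d) (plength (d_target d))) d.
by rewrite da du de plength_rsub.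
Qed.

End Existence.

(** * The coordinates determine the module up to isomorphism *)

Definition has_coords M (x : M) k : Prop :=
  [/\ exists F : nat -> {pred M}, composition_filtration p F, cyclic_top p x
    & detour_coords x k].

(** The order of quantifiers matters: [c] depends on [k] alone, which makes different modules with
    the same coordinates comparable. *)
Lemma has_coords_apath k (a : arrow Q) j : (j <= plength p)%N -> exists c,
  forall M (x : M), has_coords x k ->
    pact (pbasis K (apath a) * pbasis K (rsub p j)) x = pact (comb p c) x.
Proof.
move=> jp; case: (apath_rsub K a jp) => [e|[lt e]|dt|[_ nt]].
- by exists (fun=> 0) => M x _; rewrite e comb0.
- by exists (fun h => (h == j.+1)%:R) => M x _; rewrite e comb1.
- by exists (kcoef k a (rsub p j)) => M x [_ _ /detour_coordsP]; apply.
exists (fun=> 0) => M x [[F FF] xtop _].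
have [c c0 ->] := apath_rsub_comb FF xtop a jp.
by congr pact; apply: eq_comb => h hp; rewrite c0 // nt.
Qed.

Lemma has_coords_act k (b : pathalg K Q) : exists c,
  forall M (x : M), has_coords x k -> pact b x = pact (comb p c) x.
Proof.
elim/pathalg_ind: b => [|a b [c H] [c' H']|l q].
- by exists (fun=> 0) => M x _; rewrite comb0.
- exists (fun j => c j + c' j) => M x Hx.
  by rewrite pactDl (H _ _ Hx) (H' _ _ Hx) -pactDl combD.
suff [c H] : exists c,
    forall M (x : M), has_coords x k -> pact (pbasis K q) x = pact (comb p c) x.
  by exists (fun j => l * c j) => M x Hx; rewrite pactM (H _ _ Hx) -pactM combZ.
elim/qpath_ind: q => [e|a u q [c H] eq].
  have [->|ne] := eqVneq e (psource p).
    by exists (fun j => (j == 0)%:R) => M x _; rewrite comb1 // rsub0.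
  exists (fun=> 0) => M x [_ [ex _] _]; rewrite comb0 -ex -pactM vpath_pbasis.
  by rewrite /ptarget /= eq_sym (negbTE ne) !pact0l.
(* [C] is the matrix of the arrow [a] in the basis of the [rsub p j] applied to [x], the same for
   all modules with coordinates [k]. *)
have [C CP] := @boolp.choice 'I_(plength p).+1 _ _
  (fun j => has_coords_apath k a (ltn_ord j : (j <= plength p)%N)).
exists (fun h => \sum_(j < (plength p).+1) c j * C j h) => M x Hx.
rewrite (pbasis_pcomp K eq) pactM (H _ _ Hx) -pactM mulr_sumr pact_sum.
have -> : comb p (fun h => \sum_(j < (plength p).+1) c j * C j h) =
    \sum_(j < (plength p).+1) (c j)%:S * comb p (C j).
  under [RHS]eq_bigr => j _ do rewrite combZ.
  rewrite exchange_big; apply: eq_bigr => j _.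
  by rewrite rmorph_sum mulr_suml.
rewrite pact_sum; apply: eq_bigr => j _.
by rewrite mulrA pscalarC -mulrA pactM (CP j _ _ Hx) -pactM.
Qed.

(** Expansions at [x] are unique, and the same coefficients serve at [y]. *)
Lemma has_coords_ann k M N (x : M) (y : N) (a b : pathalg K Q) :
  has_coords x k -> has_coords y k -> pact a x = pact b x -> pact a y = pact b y.
Proof.
move=> Hx Hy; have [c cP] := has_coords_act k a; have [c' cP'] := has_coords_act k b.
rewrite (cP _ _ Hx) (cP' _ _ Hx) (cP _ _ Hy) (cP' _ _ Hy).
have [[F FF] xtop _] := Hx => e.
by congr pact; apply: eq_comb; apply: (comb_inj I_adm FF xtop e).
Qed.

Lemma has_coords_gen k M (x : M) : has_coords x k ->
  exists g : M -> pathalg K Q, forall y, pact (g y) x = y.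
Proof.
case=> [[F FF] xtop _].
have [g gP] : {g : M -> pathalg K Q & forall y, pact (g y) x = y}.
  apply: (@boolp.choice _ _ (fun y a => pact a x = y)) => y.
  have yF : y \in F 0 by case: FF => _ ->.
  by have [c _ ->] := filtration_comb I_adm FF xtop yF; exists (comb p c).
by exists g.
Qed.

Lemma has_coords_isomorphic k M N (x : M) (y : N) :
  has_coords x k -> has_coords y k -> isomorphic M N.
Proof.
move=> Hx Hy; have [g gP] := has_coords_gen Hx; have [h hP] := has_coords_gen Hy.
(* The map [a x |-> a y]; by [has_coords_ann] the chosen representative [g z] does not matter. *)
pose f (z : M) : N := pact (g z) y.
have fE a : f (pact a x) = pact a y by apply: (has_coords_ann Hx Hy); rewrite gP.
have f_lin : linear f.
  move=> r z t; have [a <-] := rquot_surj r.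
  rewrite -/(pact a z) -(gP z) -(gP t) -pactM -pactDl !fE pactDl pactM.
  by [].
pose fl : {linear M -> N} := HB.pack f (GRing.isLinear.Build _ _ _ _ f f_lin).
exists fl; exists (fun t => pact (h t) x) => z /=.
  by rewrite -{2}(gP z); apply: (has_coords_ann Hy Hx); rewrite hP.
by rewrite [LHS]fE hP.
Qed.

End Coordinates.

(** * Removing the slack coordinates *)

Section Normalisation.
Set Implicit Arguments.
Unset Strict Implicit.
Variables (K : fieldType) (Q : quiver) (I : idealType (pathalg K Q)).
Hypothesis I_adm : admissible I.
Hypothesis no_double_arrows : forall a b : arrow Q,
  source a = source b -> target a = target b -> a = b.
Variables (p : qpath Q) (M : lmodType (qalgebra I)) (F : nat -> {pred M}).
Hypothesis FF : composition_filtration p F.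
Implicit Types (u v w : qpath Q) (c : nat -> K) (k : detour_index p -> K).
Implicit Types (d : detour_index p).

Let Fsub i : submod_closed (F i). Proof. by case: FF. Qed.
Let FT x : x \in F 0. Proof. by case: FF => _ ->. Qed.

Lemma comb_path_filtration i m c (y : M) : (forall j, (j < i)%N -> c j = 0) ->
  y \in F m -> pact (comb p c) y \in F (m + i)%N.
Proof.
move=> c0 yF; rewrite /comb pact_sum.
apply: (big_ind (fun z => z \in F (m + i)%N)).
- exact: submod0 (Fsub _).
- by move=> z t; apply: (submodD (Fsub _)).
move=> j _; have [ji|ij] := ltnP j i.
  by rewrite c0 // rmorph0 mul0r pact0l; apply: submod0 (Fsub _).
rewrite pactM; apply: (submodA (Fsub _)).
have jp : (j <= plength p)%N by rewrite -ltnS.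
have := filtration_path I_adm FF (rsub p j) yF; rewrite plength_rsub //.
by apply: (filtration_anti FF); rewrite leq_add2l.
Qed.

(** * Effect on the coordinates of replacing [x] by [x - y] *)

Section ChangeTop.
Variables (x y : M) (m : nat) (k k' : detour_index p -> K).
Hypothesis m_gt0 : (0 < m)%N.
Hypothesis yF : y \in F m.
Hypothesis x'top : cyclic_top p (x - y).
Hypothesis kx : detour_coords x k.
Hypothesis k'x : detour_coords (x - y) k'.

(** The absence of double arrows enters here: the expansion of [alpha u x] starts at length
    [|u| + 2], so applied to [y] it lands one step deeper than [alpha u y] need lie. *)
Let kcoef_low d j : (j < (plength (d_path d)).+2)%N ->
  kcoef k (d_arrow d) (d_path d) j = 0.
Proof.
move=> lt; have [lu tp _] := (detour_targetsP (d_targetP d)).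
have jp : (j <= plength p)%N.
  rewrite -ltnS; apply: leq_trans lt _.
  have := detour_target_gt d no_double_arrows; case/andP: tp => _ tp gt.
  exact: leq_trans gt (leqW tp).
apply: kcoef_out => //; apply/negP => jt.
have [d' [da du dt]] := detour_indexP (d_detour d) jt.
have := detour_target_gt d' no_double_arrows.
by rewrite du dt plength_rsub // ltnNge -ltnS lt.
Qed.

Let coords_change d :
  pact (comb p (fun j => kcoef k' (d_arrow d) (d_path d) j
                         - kcoef k (d_arrow d) (d_path d) j)) (x - y) =
  pact (comb p (kcoef k (d_arrow d) (d_path d))) y
  - pact (pbasis K (apath (d_arrow d)) * pbasis K (d_path d)) y.
Proof.
have dt := d_detour d.
have/detour_coordsP/(_ _ _ dt) e' := k'x.
have/detour_coordsP/(_ _ _ dt) e := kx.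
rewrite -combB pactBl -e' pactBr e.
by rewrite [X in _ - X]pactBr opprB addrC addrA subrK.
Qed.

(** Both terms on the right of [coords_change] lie in [F (|u| + 1 + m)], so the coefficients at
    smaller lengths agree. *)
Lemma coords_change_lt d : (plength (d_target d) < (plength (d_path d)).+1 + m)%N ->
  k' d = k d.
Proof.
move=> lt; have [_ /andP[_ tp] _] := detour_targetsP (d_targetP d).
apply/eqP; rewrite -subr_eq0 -(kcoef_index k) -(kcoef_index k'); apply/eqP.
apply: (comb_filtration I_adm FF x'top (i := ((plength (d_path d)).+1 + m)%N)
  (c := fun j => kcoef k' (d_arrow d) (d_path d) j
                 - kcoef k (d_arrow d) (d_path d) j)) => //.
rewrite coords_change; apply: (submodB (Fsub _)).
  have := comb_path_filtration (@kcoef_low d) yF; apply: (filtration_anti FF).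
  by rewrite addnC leq_add2l.
have := filtration_path I_adm FF (apath (d_arrow d))
  (filtration_path I_adm FF (d_path d) yF).
by rewrite pactM addn1 [(m + _)%N]addnC addSn.
Qed.

(** Modulo [F r.+1] the right side of [coords_change] is [- alpha u y = - b v x], and [v x] may be
    replaced by [v (x - y)] because [v y] lies in [F (m + r)] with [m > 0]. *)
Lemma coords_change_eq d w (b : K) : y = pact (b%:S * pbasis K w) x ->
  pbasis K (d_target d) =
    pbasis K (apath (d_arrow d)) * pbasis K (d_path d) * pbasis K w ->
  plength (d_target d) = ((plength (d_path d)).+1 + m)%N -> k' d = k d - b.
Proof.
move=> ye te tl; have [ve /andP[_ tp] _] := detour_targetsP (d_targetP d).
set r := plength (d_target d) in ve tp tl.
(* Written as the value at [r] of a single coefficient function, to which [comb_filtration]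
   applies. *)
suff : kcoef k' (d_arrow d) (d_path d) r - kcoef k (d_arrow d) (d_path d) r
         + b * (r == r)%:R = 0.
  rewrite !kcoef_index eqxx mulr1 => /eqP.
  by rewrite -addrA addr_eq0 opprD opprK => /eqP.
apply: (comb_filtration I_adm FF x'top (i := r.+1)
  (c := fun j => kcoef k' (d_arrow d) (d_path d) j
                 - kcoef k (d_arrow d) (d_path d) j + b * (j == r)%:R)) => //.
rewrite -combD -combZ comb1 // -ve pactDl coords_change.
have -> : pact (pbasis K (apath (d_arrow d)) * pbasis K (d_path d)) y =
    pact (b%:S * pbasis K (d_target d)) x.
  by rewrite {1}ye -pactM te mulrA pscalarC !mulrA.
rewrite pactBr addrA subrK.
apply: (submodB (Fsub _)).
  have := comb_path_filtration (@kcoef_low d) yF; apply: (filtration_anti FF).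
  by rewrite tl addnC -addnS.
rewrite pactM; apply: (submodA (Fsub _)).
have := filtration_path I_adm FF (d_target d) yF; apply: (filtration_anti FF).
by rewrite -/r -add1n leq_add2r.
Qed.

End ChangeTop.

(** The path [w] ends at the source of [p], and [p w] is too long to act nontrivially. *)
Lemma cyclic_top_sub (x : M) w (b : K) : cyclic_top p x -> (0 < plength w)%N ->
  ptarget w = psource p -> cyclic_top p (x - pact (b%:S * pbasis K w) x).
Proof.
case=> ex px w0 wt; split.
  by rewrite pactBr ex -pactM mulrA pscalarC -mulrA vpath_pbasis wt eqxx.
rewrite pactBr -pactM mulrA pscalarC -mulrA pactM pactM.
have [_ _ F0 _] := FF.
have := filtration_path I_adm FF p (filtration_path I_adm FF w (FT x)).
rewrite F0; last by rewrite -[ltnLHS]add0n ltn_add2r.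
by move/eqP => ->; rewrite pact0r subr0.
Qed.

Lemma coords_normalise (S : detour_index p -> Prop) :
  (exists x : M, cyclic_top p x) ->
  (forall d, S d -> exists w, [/\ psource w = psource p, ptarget w = psource p
     & pbasis K (d_target d)
       = pbasis K (apath (d_arrow d)) * pbasis K (d_path d) * pbasis K w]) ->
  exists (x : M) k, [/\ cyclic_top p x, detour_coords x k
    & forall d, S d -> k d = 0].
Proof.
move=> [x0 x0top] Sw.
have Sarr d : S d -> exists w, [/\ ptarget w = psource p,
    pbasis K (d_target d)
      = pbasis K (apath (d_arrow d)) * pbasis K (d_path d) * pbasis K w,
    parrows (d_target d) = parrows w ++ rcons (parrows (d_path d)) (d_arrow d)
    & plength (d_target d) = ((plength (d_path d)).+1 + plength w)%N].
  case/Sw=> w [_ wt te]; exists w.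
  have te' := te; move: te'; rewrite pbasisM.
  case au: (pcomp _ _) => [v|] /= te'; last first.
    by case: (@pbasis_neq0 K _ (d_target d)); rewrite te' mul0r.
  have vw := pbasisM_some te'; have [_ _ vwa] := (pcompP _ _ _).1 vw.
  have [_ _ aua] := (pcompP _ _ _).1 au.
  split=> //; first by rewrite vwa aua cats1.
  by rewrite (plength_pcomp vw) (plength_pcomp au) addnC addn1.
(* Since [|v| = |u| + 1 + |w|], the bound means [|w| < m]; [m = plength p + 1] covers every target,
   and [m = 0] covers none. *)
suff H m : exists (x : M) k, [/\ cyclic_top p x, detour_coords x k
    & forall d, S d -> (plength (d_target d) < (plength (d_path d)).+1 + m)%N ->
        k d = 0].
  have [x [k [xtop kx k0]]] := H (plength p).+1; exists x, k; split=> // d Sd.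
  apply: k0 => //; have [_ /andP[_ tp] _] := detour_targetsP (d_targetP d).
  by rewrite addnS ltnS (leq_trans tp) // leq_addl.
elim: m => [|m [x [k [xtop kx k0]]]].
  have [k kx] := detour_coords_exist I_adm FF x0top; exists x0, k; split=> // d _.
  rewrite addn0 ltnS leqNgt.
  by have [_ /andP[-> _] _] := detour_targetsP (d_targetP d).
have [[d [Sd dm]]|nS] := boolp.EM (exists d, S d /\
    plength (d_target d) = ((plength (d_path d)).+1 + m)%N); last first.
  exists x, k; split=> // d Sd; rewrite addnS ltnS leq_eqVlt => /orP[/eqP e|].
    by case: nS; exists d.
  exact: k0.
have [w [wt te ta tl]] := Sarr d Sd.
have wm : plength w = m.
  by apply/eqP; rewrite -(eqn_add2l (plength (d_path d)).+1) -tl dm.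
have m0 : (0 < m)%N.
  have := detour_target_gt d no_double_arrows; rewrite dm.
  by rewrite -[X in (X < _)%N]addn0 ltn_add2l.
set y := pact ((k d)%:S * pbasis K w) x.
have yF : y \in F m.
  rewrite /y pactM; apply: (submodA (Fsub _)).
  by have := filtration_path I_adm FF w (FT x); rewrite wm.
have x'top : cyclic_top p (x - y) by apply: cyclic_top_sub => //; rewrite wm.
have [k' k'x] := detour_coords_exist I_adm FF x'top.
exists (x - y), k'; split=> // d' Sd'; rewrite addnS ltnS leq_eqVlt.
case/orP=> [/eqP e|lt]; last first.
  by rewrite (coords_change_lt yF x'top kx k'x lt); apply: k0.
(* Only one coordinate is treated at stage [m]: both [w] and [w'] consist of the first [m] arrows of
   [p], so [detour_index_period] applies. *)
suff -> : d' = d by rewrite (coords_change_eq m0 yF x'top kx k'x (erefl y) te dm) subrr.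
have [w' [wt' te' ta' tl']] := Sarr d' Sd'.
have wm' : plength w' = m.
  by apply/eqP; rewrite -(eqn_add2l (plength (d_path d')).+1) -tl' e.
have [ve _ _] := detour_targetsP (d_targetP d).
have [ve' _ _] := detour_targetsP (d_targetP d').
apply: (@detour_index_period _ _ d' d (parrows w)) => //.
suff <- : parrows w' = parrows w by [].
have tk (z : qpath Q) s t : z = rsub p (plength z) -> parrows z = s ++ t ->
    s = take (size s) (parrows p).
  move=> ze za; have : s = take (size s) (parrows z) by rewrite za take_size_cat.
  have le : (size s <= plength z)%N by rewrite /plength za size_cat leq_addr.
  by rewrite ze /= /parrows /= -/(parrows p) -/(plength z) take_takel.
rewrite (tk _ _ _ ve' ta') (tk _ _ _ ve ta).
by rewrite -[size (parrows w)]/(plength w) -[size _]/(plength w') wm wm'.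
Qed.

End Normalisation.

(** * Finiteness *)

Section Finiteness.
Set Implicit Arguments.
Unset Strict Implicit.

Lemma roots_finite (K : fieldType) (f : {poly K}) :
  f != 0 -> exists s : seq K, forall c, root f c -> c \in s.
Proof.
have [n] := ubnP (size f); elim: n f => // n IH f lt f0.
have [[c rc]|nr] := boolp.EM (exists c, root f c); last first.
  by exists [::] => c rc; case: nr; exists c.
have /factor_theorem[g fg] := rc.
have g0 : g != 0 by apply: contraNneq f0 => g0; rewrite fg g0 mul0r.
have [|s sP] := IH g _ g0.
  by move: lt; rewrite fg size_Mmonic ?monicXsubC // size_XsubC addn2.
exists (c :: s) => b; rewrite fg rootM root_XsubC inE => /orP[/sP ->|->] //.
by rewrite orbT.
Qed.

Import mpoly.

Variables (K : fieldType) (Q : quiver) (I : idealType (pathalg K Q)).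
Variable (p : qpath Q).

(** An algebraic relation in the coordinate ring, evaluated at a point [k], makes [k d] a root of
    [f]. *)
Lemma not_transcendental_finite (d : detour_index p) :
  ~ transcendental (coord_X I d) ->
  exists s : seq K, forall k, in_V I k -> k d \in s.
Proof.
move=> /boolp.existsNP[f /boolp.not_implyP[fz /eqP f0]].
have [s sP] := roots_finite f0; exists s => k kV; apply: sP.
move: fz; pose g := \sum_(i < size f) (f`_i)%:MP * Defs.X K d ^+ i.
have -> : \sum_(i < size f) coord_const I p f`_i * coord_X I d ^+ i
    = rquot (vanishing I (p := p)) g.
  by rewrite rmorph_sum; apply: eq_bigr => i _; rewrite rmorphM rmorphXn.
move/eqP; rewrite rquot_eq0 => /vanishingP/(_ _ kV).
rewrite rmorph_sum => e; apply/rootP; rewrite horner_coef -[RHS]e.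
apply: eq_bigr => i _.
by rewrite rmorphM rmorphXn /= mevalC mevalXU enum_rankK.
Qed.

(** Zero satisfies the polynomial ['X], so a transcendental coordinate is nonzero and its detour is
    a halyard. *)
Lemma transcendental_slack (d : detour_index p) :
  transcendental (coord_X I d) -> slack_variable I d.
Proof.
move=> tr; split=> //; split; first exact: d_detour.
exists d; split=> // X0; have := tr 'X; rewrite size_polyX !big_ord_recl big_ord0.
rewrite X0 /= !coefX /= expr1 mulr0 !addr0 expr0 mulr1.
rewrite /coord_const mpolyC0 rmorph0 => /(_ erefl)/eqP.
by rewrite polyX_eq0.
Qed.

End Finiteness.

Theorem theorem5p7 (K : fieldType)
  (K_infinite : forall s : seq K, exists c : K, c \notin s)
  (Gamma : quiver) (I : idealType (pathalg K Gamma)) (I_adm : admissible I)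
  (no_double_arrows : forall a b : arrow Gamma,
     source a = source b -> target a = target b -> a = b)
  (p : qpath Gamma) (p_mast : mast I p) (p_pos : (0 < plength p)%N)
  (p_slack : forall d : detour_index p,
     slack_halyard I p (d_arrow d) (d_path d) -> slack_variable I d ->
     exists w : qpath Gamma,
       [/\ right_subpath w p, psource w = psource p, ptarget w = psource p
         & pbasis K (d_target d)
           = pbasis K (apath (d_arrow d)) * pbasis K (d_path d) * pbasis K w]) :
  exists (n : nat) (U : 'I_n -> lmodType (qalgebra I)),
    forall M : lmodType (qalgebra I), finitely_generated M -> mast_of M p ->
      exists i : 'I_n, isomorphic M (U i).
Proof.
pose k_of (V : seq K) (g : {ffun detour_index p -> seq_sub V}) d := val (g d).
(* The values allowed after normalisation: zero for a slack variable, finitely many roots for any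
   other. *)
have [s sP] : {s : detour_index p -> seq K & forall d,
    (slack_variable I d -> 0 \in s d) /\
    (~ slack_variable I d -> forall k, in_V I k -> k d \in s d)}.
  apply: (@boolp.choice _ _ (fun d t => (slack_variable I d -> 0 \in t) /\
    (~ slack_variable I d -> forall k, in_V I k -> k d \in t))) => d.
  have [sl|nsl] := boolp.EM (slack_variable I d).
    by exists [:: 0]; split=> // _; rewrite inE.
  have [|t tP] := @not_transcendental_finite _ _ I _ d.
    by move/transcendental_slack.
  by exists t.
pose V := flatten [seq s d | d : detour_index p].
have [U UP] : {U : 'I_#|{ffun detour_index p -> seq_sub V}| -> lmodType (qalgebra I) &
    forall i (M : lmodType (qalgebra I)),
      (exists x : M, has_coords x (k_of V (enum_val i))) -> isomorphic M (U i)}.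
  apply: (@boolp.choice _ _ (fun i N => forall M : lmodType (qalgebra I),
      (exists x : M, has_coords x (k_of V (enum_val i))) -> isomorphic M N)) => i.
  (* Each candidate point gets a module realising it; if there is none, the module given by [p_mast]
     is a harmless default. *)
  have [[N [y yP]]|no] := boolp.EM (exists N : lmodType (qalgebra I),
      exists x : N, has_coords x (k_of V (enum_val i))).
    by exists N => M [x xP]; apply: has_coords_isomorphic xP yP.
  by case: p_mast => N _ _; exists N => M Mx; case: no; exists M.
exists #|{ffun detour_index p -> seq_sub V}|, U => M Mfg Mp.
have [F FF] := filtration_exists Mp.
have [d sd|x [k [xtop kx k0]]] := coords_normalise I_adm no_double_arrows FF
    (S := slack_variable I (p:=p)) (cyclic_top_exists Mp).
  have [|w [_ ws wt we]] := p_slack d _ sd; last by exists w.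
  by split; [case: sd | exists d].
(* The changed [x] is still a top element, so [k] is a point of [V_p] and the bounds on its other
   coordinates apply. *)
have kV : in_V I k.
  by exists M, x; split=> //; apply: cyclic_top_element FF _ xtop.
have kin d : k d \in V.
  apply/flatten_mapP; exists d; first by rewrite mem_enum.
  have [sl|nsl] := boolp.EM (slack_variable I d); last by case: (sP d) => _; apply.
  by rewrite k0 //; case: (sP d) => + _; apply.
pose g : {ffun detour_index p -> seq_sub V} := [ffun d => SeqSub (kin d)].
exists (enum_rank g); apply: UP; exists x; rewrite enum_rankK.
have -> : k_of V g = k by apply: boolp.funext => d; rewrite /k_of ffunE.
by split=> //; exists F.
Qed.
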